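(* Consider the semidiscrete scheme coupling two grid blocks $\Omega_u$ and $\Omega_v$ across an interface $\Gamma$, $$\begin{aligned} \rho^u\ddot{\mathbf u}_J&=\mathbb D^{\Omega_u}_{IK}(C^u_{IJKL})\mathbf u_L-(\mathcal J^uH^u)^{-1}e^u_\Gamma\mathbb Z_{LJ}\hat JH_\Gamma\,\boldsymbol\delta_L+\tfrac12(\mathcal J^uH^u)^{-1}(\mathbb T^u_{LJ})^Te^u_\Gamma\hat JH_\Gamma\,\boldsymbol\delta_L\\ &\quad-\tfrac12(\mathcal J^uH^u)^{-1}e^u_\Gamma\hat JH_\Gamma\,\boldsymbol\sigma_J+\mathbf B^u_J,\\ \rho^v\ddot{\mathbf v}_J&=\mathbb D^{\Omega_v}_{IK}(C^v_{IJKL})\mathbf v_L+(\mathcal J^vH^v)^{-1}e^v_\Gamma\mathbb Z_{LJ}\hat JH_\Gamma\,\boldsymbol\delta_L-\tfrac12(\mathcal J^vH^v)^{-1}(\mathbb T^v_{LJ})^Te^v_\Gamma\hat JH_\Gamma\,\boldsymbol\delta_L\\ &\quad-\tfrac12(\mathcal J^vH^v)^{-1}e^v_\Gamma\hat JH_\Gamma\,\boldsymbol\sigma_J+\mathbf B^v_J, \end{aligned}$$ where $$\boldsymbol\delta_L=(e^u_\Gamma)^T\mathbf u_L-(e^v_\Gamma)^T\mathbf v_L-\mathbf V_L,\qquad \boldsymbol\sigma_J=(e^u_\Gamma)^T\mathbb T^u_{JL}\mathbf u_L+(e^v_\Gamma)^T\mathbb T^v_{JL}\mathbf v_L-\boldsymbol\Theta_J,$$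 $$\mathbb Z_{JL}=\beta\,\frac{d}{4h_1}\,\hat J\left(\frac{n^u_IC^u_{IJKL}n^u_K}{\mathcal J^u}+\frac{n^v_IC^v_{IJKL}n^v_K}{\mathcal J^v}\right),\qquad\beta\ge1,$$ and $\mathbf B^u_J,\mathbf B^v_J$ are the outer-boundary terms specified in the context. The scheme is stable, in the following sense: for $\mathbf V_J=\boldsymbol\Theta_J=0$ every solution satisfies $\frac{d}{dt}E_I=0$, where $$E_I=E_u+E_v+\tfrac12(\mathbf u_J-\mathbf v_J,\mathbb Z_{JL}(\mathbf u_L-\mathbf v_L))_\Gamma-\tfrac12(\mathbf u_J-\mathbf v_J,\mathbb T^u_{JL}\mathbf u_L-\mathbb T^v_{JL}\mathbf v_L)_\Gamma,$$ $$E_u=\tfrac12(\dot{\mathbf u}_J,\rho^u\dot{\mathbf u}_J)_{\Omega_u}+\tfrac12(D^u_I\mathbf u_J,C^u_{IJKL}D^u_K\mathbf u_L)_{\Omega_u}+\tfrac12\mathbf u_J^T\mathbb W^u_{JL}\mathbf u_L,$$ $E_v$ is defined analogously, and $E_I\ge0$ for all $\mathbf u_J,\dot{\mathbf u}_J,\mathbf v_J,\dot{\mathbf v}_J$.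
   Context: Conventions. Repeated subscripts $i,j,k,\ell,I,J,K,L$ are summed from $1$ to $d$, also inside bilinear forms, except where ''no sum'' is stated (the subscript in the symbol $E_I$ is just a label). Boldface symbols are real grid vectors. A spatially variable coefficient is identified with the diagonal matrix of its grid values. Superscripts $u,v$ mark quantities belonging to the blocks $\Omega_u,\Omega_v$. The scheme approximates $\rho^u\ddot u_J=\partial_IC^u_{IJKL}\partial_Ku_L$ in $\Omega_u$, $\rho^v\ddot v_J=\partial_IC^v_{IJKL}\partial_Kv_L$ in $\Omega_v$, with interface conditions $u_J-v_J=V_J$ and $\tau^u_J+\tau^v_J=\Theta_J$ on $\Gamma$ ($\tau_J=n_IC_{IJKL}\partial_Ku_L$ is the traction). For each block $\Omega\in\{\Omega_u,\Omega_v\}$ the following are defined (superscript $u$ or $v$ suppressed). $\Omega\subset\mathbb R^d$ is the image of the reference cube $\omega=[0,1]^d$ (coordinates $x_i$) under a smooth one-to-one map $X_I=X_I(x_1,\dots,x_d)$. One-dimensional operators. On a grid of $[0,1]$ including both end points, $H_x=\mathrm{diag}(h_1,h_2,\dots,h_2,h_1)$ has positive diagonal entries (proportional to the grid spacing $h$); $e_0=(1,0,\dots,0)^T$, $e_N=(0,\dots,0,1)^T$. The first-derivative summation-by-parts (SBP) operator $D_x\approx\partial_x$ satisfies $H_xD_x=-D_x^TH_x-e_0e_0^T+e_Ne_N^T$. The fully compatible second-derivative SBP operator $D^{FC}_{xx}(b)\approx\partial_x b\,\partial_x$ satisfies $$H_xD^{FC}_{xx}(b)=-D_x^TH_xbD_x-R_{xx}(b)-e_0e_0^TbD_x+e_Ne_N^TbD_x,$$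 where $R_{xx}(b)=\sum_\alpha\mathcal D_{x^\alpha}^TB_\alpha(b)\mathcal D_{x^\alpha}$, the matrices $\mathcal D_{x^\alpha}$ do not depend on $b$, and $B_\alpha(b)$ is diagonal with entries $(B_\alpha(b))_r=\sum_s\beta_{\alpha,r,s}b_s$, $\beta_{\alpha,r,s}\ge0$, $b_s$ being the value of $b$ at grid point $s$. The same grid spacing (hence the same $h_1$) is used in each coordinate direction and in both blocks. Multi-dimensional operators on $\omega$. $D_i=I\otimes\cdots\otimes D_{x_i}\otimes\cdots\otimes I$ (with $D_{x_i}$ in position $i$); $D^{FC}_{ii}(b)$ (no sum) applies $D^{FC}_{xx}(b)$ along each grid line in direction $i$; $\mathbb D_{ij}(b)=D^{FC}_{ii}(b)$ if $i=j$ and $\mathbb D_{ij}(b)=D_i\,b\,D_j$ if $i\ne j$. $H=H_{x_1}\otimes\cdots\otimes H_{x_d}$. The faces of $\omega$ are $\partial\omega_i^-=\{x_i=0\}$, $\partial\omega_i^+=\{x_i=1\}$; $\mathcal F$ is the set of all $2d$ faces. For $f=\partial\omega_i^\pm$, $e_f^T$ restricts a grid vector to the grid points of $f$, and $H_f=H_{x_1}\otimes\cdots\otimes H_{x_{i-1}}\otimes H_{x_{i+1}}\otimes\cdots\otimes H_{x_d}$. $R_{ii}(b)$ (no sum) is the matrix that applies $R_{xx}(b)$ along each grid line in direction $i$ and weights each grid line with the corresponding diagonal entry of $H_{\partial\omega_i^\pm}$. Metric quantities. $F_{Ii}$ are the grid values of (a possibly approximate) transformation gradient $\partial x_i/\partial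 X_I$, invertible at each grid point; $\mathcal J=\det[(F^{-1})_{iI}]>0$ is the Jacobian determinant (written $\mathcal J$ to distinguish it from the index $J$); $\nu_i$ is the outward unit normal of $\omega$; $\hat J>0$ is the surface area scale factor; $n_I=\hat J^{-1}\mathcal JF_{Ii}\nu_i$ is the outward normal of $\Omega$. The quantities $\nu_i,n_I,\hat J$ are defined face by face: in any expression associated with a face $f$ they take the values belonging to $f$, also at edge and corner points. $D_I=F_{Ii}D_i$. Material. $\rho>0$ is the density. The real stiffness tensor satisfies, at each grid point, $C_{IJKL}=C_{KLIJ}$ and $S_{IJ}C_{IJKL}S_{KL}\ge0$ for all $S_{IJ}$. The transformed stiffness tensor is $c_{iJkL}=F_{Ii}\,\mathcal J\,C_{IJKL}F_{Kk}$. Define $$\mathbb D^\Omega_{IK}(C_{IJKL})=\mathcal J^{-1}\mathbb D_{ik}(c_{iJkL}),\qquad \mathbb W_{JL}=\sum_kR_{kk}(c_{kJkL}),\qquad \mathbb T_{JL}=n_IC_{IJKL}D_K .$$ The discrete volume integral is $(\mathbf a,\mathbf b)_\Omega=\mathbf a^T\mathcal JH\mathbf b$. Interface. $\Gamma$ is a full face of each block; the grid points of the two blocks on $\Gamma$ coincide, the face quadrature $H_\Gamma$ and the scale factor $\hat J$ on $\Gamma$ are the same from both sides, and $(e^u_\Gamma)^T$, $(e^v_\Gamma)^T$ restrict grid vectors of each block to the points of $\Gamma$. On $\Gamma$, $\mathbb T^{u}_{JL},\mathbb T^{v}_{JL}$ are formed with the normals $n^u,n^v$ to $\Gamma$ outward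 from the respective block, and $\mathbb Z_{JL}$ is a diagonal matrix of grid values on $\Gamma$. For grid vectors $\mathbf a,\mathbf b$ (each restricted to $\Gamma$ with the restriction operator of its own block), $(\mathbf a,\mathbf b)_\Gamma=\mathbf a|_\Gamma^T\hat JH_\Gamma\,\mathbf b|_\Gamma$. The material parameters, $F_{Ii}$ and $\mathcal J$ may be discontinuous across $\Gamma$. Outer boundaries. Outer-boundary terms are disregarded in the analysis: $\mathbf B^u_J,\mathbf B^v_J$ are the penalty terms that exactly remove the outer-boundary contributions (those of homogeneous traction conditions), $\mathbf B^u_J=-(\mathcal J^uH^u)^{-1}\sum_{f\in\mathcal F^u,\,f\ne\Gamma}e_f\hat JH_fe_f^T\mathbb T^u_{JL}\mathbf u_L$, and analogously $\mathbf B^v_J$. *)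

(* Defs.v *)
From HB Require Import structures.
From mathcomp Require Import all_boot all_order all_algebra.
From mathcomp Require Import all_classical all_reals all_analysis.

Set Implicit Arguments.
Unset Strict Implicit.
Unset Printing Implicit Defensive.

Import Order.TTheory GRing.Theory Num.Theory.
Import numFieldNormedType.Exports.

Local Open Scope classical_set_scope.
Local Open Scope ring_scope.

(* Matrices whose rows and columns are labelled by finite types, carried by the
   library's matrices through enum_val. *)
Definition fmx (R : Type) (S T : finType) (k : S -> T -> R) : 'M[R]_(#|S|, #|T|) :=
  \matrix_(i, j) k (enum_val i) (enum_val j).

Definition fdiag (R : realType) (T : finType) (b : T -> R) : 'M[R]_#|T| :=
  diag_mx (\row_i b (enum_val i)).

Definition bil (R : realType) (n : nat)
    (a : 'cV[R]_n) (M : 'M[R]_n) (b : 'cV[R]_n) : R :=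
  (a^T *m M *m b) 0 0.

Definition e_pt (R : realType) (N : nat) (r : 'I_N.+1) : 'cV[R]_N.+1 :=
  delta_mx r 0.

(* The dissipative part R_xx(b) of D2 is the sum over the index [a] of
   Dx_a^T B_a(b) Dx_a, where B_a(b) is diagonal and linear in b with
   nonnegative weights. Dx_a may be rectangular, with [sbp_rows a] rows.
   [sbp_wsym] renders the pattern diag(h1, h2, .., h2, h1). The identity for D2
   is required for b of any sign, because D2 is also applied to the off-diagonal
   components of a stiffness tensor. *)
Record sbp_op (R : realType) (N : nat) (h1 : R) := SbpOp {
  sbp_w : 'rV[R]_N.+1;
  sbp_D : 'M[R]_N.+1;
  sbp_D2 : 'rV[R]_N.+1 -> 'M[R]_N.+1;
  sbp_nd : nat;
  sbp_rows : 'I_sbp_nd -> nat;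
  sbp_Dx : forall a : 'I_sbp_nd, 'M[R]_(sbp_rows a, N.+1);
  sbp_beta : forall a : 'I_sbp_nd, 'I_(sbp_rows a) -> 'I_N.+1 -> R;
  sbp_Hx : 'M[R]_N.+1 := diag_mx sbp_w;
  sbp_B (a : 'I_sbp_nd) (b : 'rV[R]_N.+1) : 'M[R]_(sbp_rows a) :=
    diag_mx (\row_r \sum_s sbp_beta r s * b 0 s);
  sbp_Rxx (b : 'rV[R]_N.+1) : 'M[R]_N.+1 :=
    \sum_a (sbp_Dx a)^T *m sbp_B a b *m sbp_Dx a;
  sbp_w_gt0 : forall s, 0 < sbp_w 0 s;
  sbp_wsym : forall s, sbp_w 0 (rev_ord s) = sbp_w 0 s;
  sbp_w0 : sbp_w 0 ord0 = h1;
  sbp_beta_ge0 : forall (a : 'I_sbp_nd) (r : 'I_(sbp_rows a)) s,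
    0 <= sbp_beta r s;
  sbp_DP : sbp_Hx *m sbp_D =
    - (sbp_D^T *m sbp_Hx) - e_pt R ord0 *m (e_pt R ord0)^T
    + e_pt R ord_max *m (e_pt R ord_max)^T;
  sbp_D2P : forall b, sbp_Hx *m sbp_D2 b =
    - (sbp_D^T *m sbp_Hx *m diag_mx b *m sbp_D) - sbp_Rxx b
    - e_pt R ord0 *m (e_pt R ord0)^T *m diag_mx b *m sbp_D
    + e_pt R ord_max *m (e_pt R ord_max)^T *m diag_mx b *m sbp_D }.

Definition grid (d N : nat) : finType := {ffun 'I_d -> 'I_N.+1}.

(* (i, false) is the face x_i = 0 and (i, true) the face x_i = 1. *)
Definition face (d : nat) : finType := ('I_d * bool)%type.

Definition endpt (N : nat) (s : bool) : 'I_N.+1 := if s then ord_max else ord0.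

Definition facept (d N : nat) (f : face d) : finType :=
  {p : grid d N | p f.1 == endpt N f.2}.

Definition outward (R : realType) (d : nat) (f : face d) (i : 'I_d) : R :=
  if i == f.1 then (if f.2 then 1 else -1) else 0.

Definition e_face (R : realType) (d N : nat) (f : face d) :
    'M[R]_(#|grid d N|, #|facept N f|) :=
  fmx (fun p q => (p == val q)%:R).

Definition kron (R : realType) (d N : nat) (A : 'I_d -> 'M[R]_N.+1) :
    'M[R]_#|grid d N| :=
  fmx (fun p q : grid d N => \prod_i A i (p i) (q i)).

Definition same_line (d N : nat) (i : 'I_d) (p q : grid d N) : bool :=
  [forall j, (j != i) ==> (p j == q j)].

Definition line (R : realType) (d N : nat) (i : 'I_d) (b : grid d N -> R)
    (p : grid d N) : 'rV[R]_N.+1 :=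
  \row_s b [ffun j => if j == i then s else p j].

Section Reference.
Context (R : realType) (d N : nat) (h1 : R) (S : 'I_d -> sbp_op N h1).

Definition Dmx (i : 'I_d) : 'M[R]_#|grid d N| :=
  kron (fun j => if j == i then sbp_D (S i) else 1%:M).

Definition Hmx : 'M[R]_#|grid d N| := kron (fun j => sbp_Hx (S j)).

Definition Hface_entry (f : face d) (p q : grid d N) : R :=
  \prod_(j | j != f.1) sbp_Hx (S j) (p j) (q j).

Definition Hface (f : face d) : 'M[R]_#|facept N f| :=
  fmx (fun p q : facept N f => Hface_entry f (val p) (val q)).

Definition D2mx (i : 'I_d) (b : grid d N -> R) : 'M[R]_#|grid d N| :=
  fmx (fun p q => if same_line i p q
                  then sbp_D2 (S i) (line i b p) (p i) (q i) else 0).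

(* The weight of a grid line in direction i is the diagonal entry of the
   quadrature of either face normal to i; it does not involve p i. *)
Definition Rmx (i : 'I_d) (b : grid d N -> R) : 'M[R]_#|grid d N| :=
  fmx (fun p q => if same_line i p q
                  then Hface_entry (i, false) p p
                       * sbp_Rxx (S i) (line i b p) (p i) (q i) else 0).

Definition DDmx (i j : 'I_d) (b : grid d N -> R) : 'M[R]_#|grid d N| :=
  if i == j then D2mx i b else Dmx i *m fdiag b *m Dmx j.

End Reference.

(* [blk_F p I i] is the value at p of dx_i/dX_I. Only the values of
   [blk_Jhat f] at the points of the face f are meaningful. *)
Record block (R : realType) (d N : nat) (h1 : R) := Block {
  blk_sbp : 'I_d -> sbp_op N h1;
  blk_F : grid d N -> 'M[R]_d;
  blk_Jhat : face d -> grid d N -> R;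
  blk_rho : grid d N -> R;
  blk_C : 'I_d -> 'I_d -> 'I_d -> 'I_d -> grid d N -> R;
  blk_J (p : grid d N) : R := \det (invmx (blk_F p));
  blk_F_unit : forall p, blk_F p \in unitmx;
  blk_J_gt0 : forall p, 0 < blk_J p;
  blk_Jhat_gt0 : forall (f : face d) (q : facept N f), 0 < blk_Jhat f (val q);
  blk_rho_gt0 : forall p, 0 < blk_rho p;
  blk_C_sym : forall I J K L p, blk_C I J K L p = blk_C K L I J p;
  blk_C_psd : forall p (T : 'I_d -> 'I_d -> R),
    0 <= \sum_I \sum_J \sum_K \sum_L T I J * blk_C I J K L p * T K L }.

Section BlockOps.
Context (R : realType) (d N : nat) (h1 : R) (b : block d N h1).

Local Notation S := (blk_sbp b).
Local Notation F := (blk_F b).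
Local Notation Jac := (blk_J b).
Local Notation C := (blk_C b).

Definition blk_H : 'M[R]_#|grid d N| := Hmx S.

Definition blk_JH : 'M[R]_#|grid d N| := fdiag Jac *m blk_H.

Definition blk_c (i J k L : 'I_d) (p : grid d N) : R :=
  \sum_I \sum_K F p I i * Jac p * C I J K L p * F p K k.

Definition blk_n (f : face d) (I : 'I_d) (p : grid d N) : R :=
  (blk_Jhat b f p)^-1 * Jac p * \sum_i F p I i * outward R f i.

Definition blk_D (I : 'I_d) : 'M[R]_#|grid d N| :=
  \sum_i fdiag (fun p => F p I i) *m Dmx S i.

(* The indices I and K of C_IJKL are summed. *)
Definition blk_DD (J L : 'I_d) : 'M[R]_#|grid d N| :=
  fdiag (fun p => (Jac p)^-1) *m \sum_i \sum_k DDmx S i k (blk_c i J k L).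

Definition blk_W (J L : 'I_d) : 'M[R]_#|grid d N| :=
  \sum_k Rmx S k (blk_c k J k L).

(* Defined on the whole grid; only the rows at points of f are meaningful. *)
Definition blk_T (f : face d) (J L : 'I_d) : 'M[R]_#|grid d N| :=
  \sum_I \sum_K fdiag (fun p => blk_n f I p * C I J K L p) *m blk_D K.

Definition blk_JhatF (f : face d) : 'M[R]_#|facept N f| :=
  fdiag (fun q : facept N f => blk_Jhat b f (val q)).

(* Outer-boundary penalty when g is the interface face. *)
Definition blk_B (g : face d) (w : 'I_d -> 'cV[R]_#|grid d N|) (J : 'I_d) :
    'cV[R]_#|grid d N| :=
  - (invmx blk_JH *m \sum_(f : face d | f != g) \sum_L
       e_face R N f *m blk_JhatF f *m Hface S f *m (e_face R N f)^T
       *m blk_T f J L *m w L).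

Definition blk_energy (w wt : 'I_d -> 'cV[R]_#|grid d N|) : R :=
  2^-1 * (\sum_J bil (wt J) blk_JH (fdiag (blk_rho b) *m wt J))
  + 2^-1 * (\sum_I \sum_J \sum_K \sum_L
       bil (blk_D I *m w J) blk_JH (fdiag (C I J K L) *m (blk_D K *m w L)))
  + 2^-1 * (\sum_J \sum_L bil (w J) (blk_W J L) (w L)).

End BlockOps.

(* Gamma is the face [ifc_fu] of the first block and [ifc_fv] of the second
   one. [ifc_map] sends a grid point of Gamma, labelled in the first block, to
   the label in the second block of the same physical point. Grid vectors on
   Gamma are indexed by the labels of the first block. *)
Record interface (R : realType) (d N : nat) (h1 : R)
    (bu bv : block d N h1) := Interface {
  ifc_fu : face d;
  ifc_fv : face d;
  ifc_map : facept N ifc_fu -> facept N ifc_fv;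
  ifc_bij : bijective ifc_map;
  ifc_H : forall p q : facept N ifc_fu,
    Hface_entry (blk_sbp bu) ifc_fu (val p) (val q) =
    Hface_entry (blk_sbp bv) ifc_fv (val (ifc_map p)) (val (ifc_map q));
  ifc_Jhat : forall p : facept N ifc_fu,
    blk_Jhat bu ifc_fu (val p) = blk_Jhat bv ifc_fv (val (ifc_map p)) }.

Section InterfaceOps.
Context (R : realType) (d N : nat) (h1 : R) (bu bv : block d N h1).
Context (G : interface bu bv).

Local Notation gpt := (facept N (ifc_fu G)).
Local Notation vec := 'cV[R]_#|grid d N|.
Local Notation gvec := 'cV[R]_#|gpt|.

Definition e_u : 'M[R]_(#|grid d N|, #|gpt|) := e_face R N (ifc_fu G).

Definition e_v : 'M[R]_(#|grid d N|, #|gpt|) :=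
  fmx (fun p (q : gpt) => (p == val (ifc_map q))%:R).

Definition HG : 'M[R]_#|gpt| := Hface (blk_sbp bu) (ifc_fu G).

Definition JhatG : 'M[R]_#|gpt| := blk_JhatF bu (ifc_fu G).

Definition T_u (J L : 'I_d) := blk_T bu (ifc_fu G) J L.
Definition T_v (J L : 'I_d) := blk_T bv (ifc_fv G) J L.

Definition nCn (b : block d N h1) (f : face d) (J L : 'I_d) (p : grid d N) : R :=
  \sum_I \sum_K blk_n b f I p * blk_C b I J K L p * blk_n b f K p.

Definition Z (beta : R) (J L : 'I_d) : 'M[R]_#|gpt| :=
  fdiag (fun q : gpt =>
    beta * (d%:R / (4 * h1)) * blk_Jhat bu (ifc_fu G) (val q) *
    (nCn bu (ifc_fu G) J L (val q) / blk_J bu (val q)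
     + nCn bv (ifc_fv G) J L (val (ifc_map q)) / blk_J bv (val (ifc_map q)))).

Definition delta (V : 'I_d -> gvec) (u v : 'I_d -> vec) (L : 'I_d) : gvec :=
  e_u^T *m u L - e_v^T *m v L - V L.

Definition sigma (Theta : 'I_d -> gvec) (u v : 'I_d -> vec) (J : 'I_d) : gvec :=
  \sum_L (e_u^T *m T_u J L *m u L) + \sum_L (e_v^T *m T_v J L *m v L) - Theta J.

Definition rhs_u (beta : R) (V Theta : 'I_d -> gvec) (u v : 'I_d -> vec)
    (J : 'I_d) : vec :=
  \sum_L blk_DD bu J L *m u L
  - \sum_L invmx (blk_JH bu) *m e_u *m Z beta L J *m JhatG *m HG
      *m delta V u v L
  + 2^-1 *: (\sum_L invmx (blk_JH bu) *m (T_u L J)^T *m e_u *m JhatG *m HG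
      *m delta V u v L)
  - 2^-1 *: (invmx (blk_JH bu) *m e_u *m JhatG *m HG *m sigma Theta u v J)
  + blk_B bu (ifc_fu G) u J.

Definition rhs_v (beta : R) (V Theta : 'I_d -> gvec) (u v : 'I_d -> vec)
    (J : 'I_d) : vec :=
  \sum_L blk_DD bv J L *m v L
  + \sum_L invmx (blk_JH bv) *m e_v *m Z beta L J *m JhatG *m HG
      *m delta V u v L
  - 2^-1 *: (\sum_L invmx (blk_JH bv) *m (T_v L J)^T *m e_v *m JhatG *m HG
      *m delta V u v L)
  - 2^-1 *: (invmx (blk_JH bv) *m e_v *m JhatG *m HG *m sigma Theta u v J)
  + blk_B bv (ifc_fv G) v J.

Definition energy (beta : R) (u ut v vt : 'I_d -> vec) : R :=
  let jump J := e_u^T *m u J - e_v^T *m v J in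
  let Tdiff J := \sum_L (e_u^T *m (T_u J L *m u L) - e_v^T *m (T_v J L *m v L)) in
  blk_energy bu u ut + blk_energy bv v vt
  + 2^-1 * (\sum_J \sum_L bil (jump J) (JhatG *m HG) (Z beta J L *m jump L))
  - 2^-1 * (\sum_J bil (jump J) (JhatG *m HG) (Tdiff J)).

End InterfaceOps.

Arguments rhs_u {R d N h1 bu bv} G beta V Theta u v J.
Arguments rhs_v {R d N h1 bu bv} G beta V Theta u v J.
Arguments energy {R d N h1 bu bv} G beta u ut v vt.

Definition ddt (R : realType) (n : nat) (w : R -> 'cV[R]_n) (t : R) : 'cV[R]_n :=
  \col_p derive1 (fun s : R => w s p 0) t.

Definition differentiable_at (R : realType) (n : nat) (w : R -> 'cV[R]_n)
    (t : R) : Prop :=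
  forall p, derivable (fun s : R => w s p 0) t 1.

Definition is_solution (R : realType) (d N : nat) (h1 : R)
    (bu bv : block d N h1) (G : interface bu bv) (beta : R)
    (V Theta : 'I_d -> R -> 'cV[R]_#|facept N (ifc_fu G)|)
    (time : set R) (u v : 'I_d -> R -> 'cV[R]_#|grid d N|) : Prop :=
  forall (J : 'I_d) (t : R), time t ->
  [/\ differentiable_at (u J) t /\ differentiable_at (ddt (u J)) t,
      differentiable_at (v J) t /\ differentiable_at (ddt (v J)) t,
      fdiag (blk_rho bu) *m ddt (ddt (u J)) t =
        rhs_u G beta (V^~ t) (Theta^~ t) (u^~ t) (v^~ t) J
    & fdiag (blk_rho bv) *m ddt (ddt (v J)) t =
        rhs_v G beta (V^~ t) (Theta^~ t) (u^~ t) (v^~ t) J].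

Arguments is_solution {R d N h1 bu bv} G beta V Theta time u v.

(* Main.v *)
(* Stability.  Summation by parts turns the work of D(C) into minus the symmetric
   form strain + dissipation plus one traction work per face.  The outer faces
   are cancelled by the penalties B; on the interface the remaining terms are
   exactly minus the rate of the two interface terms of the energy.

   Nonnegativity.  The strain energy is a sum of nonnegative pointwise terms, and
   its terms at the points of the interface carry the weight h1 * H_Gamma.  There
   they absorb the indefinite term (jump, traction) by completing a square in the
   semi-inner product of the stiffness tensor.  The square costs Jhat / (4 h1 J) * nCn
   per block, which Z provides because d * beta >= 1. *)
Require Import Defs.
From mathcomp Require Import all_boot all_order all_algebra.
From mathcomp Require Import all_classical all_reals all_analysis.
From mathcomp Require Import ring.
Import Order.TTheory GRing.Theory Num.Theory.
Import numFieldNormedType.Exports.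
Local Open Scope classical_set_scope.
Local Open Scope ring_scope.

Set Implicit Arguments.
Unset Strict Implicit.
Unset Printing Implicit Defensive.

(** * Grid vectors as functions of the grid points *)

Definition at_pt (R : realType) (T : finType) (a : 'cV[R]_#|T|) (p : T) : R :=
  a (enum_rank p) 0.

Section Labelled.
Context (R : realType).
Implicit Types S T : finType.

Lemma sum_enum_val T (F : T -> R) :
  \sum_(i < #|T|) F (enum_val i) = \sum_x F x.
Proof. by rewrite -big_enum_val; apply: eq_bigl. Qed.

Lemma at_pt_fmx S T (k : S -> T -> R) (a : 'cV[R]_#|T|) p :
  at_pt (fmx k *m a) p = \sum_q k p q * at_pt a q.
Proof.
rewrite [LHS]mxE -[RHS]sum_enum_val; apply: eq_bigr => j _.
by rewrite mxE enum_rankK /at_pt enum_valK.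
Qed.

Lemma at_pt_fdiag T (b : T -> R) (a : 'cV[R]_#|T|) p :
  at_pt (fdiag b *m a) p = b p * at_pt a p.
Proof. by rewrite /at_pt mul_diag_mx !mxE enum_rankK. Qed.

Lemma at_ptD T (a b : 'cV[R]_#|T|) p : at_pt (a + b) p = at_pt a p + at_pt b p.
Proof. by rewrite /at_pt mxE. Qed.

Lemma at_ptN T (a : 'cV[R]_#|T|) p : at_pt (- a) p = - at_pt a p.
Proof. by rewrite /at_pt mxE. Qed.

Lemma at_ptB T (a b : 'cV[R]_#|T|) p : at_pt (a - b) p = at_pt a p - at_pt b p.
Proof. by rewrite /at_pt !mxE. Qed.

Lemma at_pt_sum T (I : finType) (P : pred I) (a : I -> 'cV[R]_#|T|) p :
  at_pt (\sum_(i | P i) a i) p = \sum_(i | P i) at_pt (a i) p.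
Proof. by rewrite /at_pt summxE. Qed.

Lemma bil_sum_pt T (a : 'cV[R]_#|T|) M (b : 'cV[R]_#|T|) :
  bil a M b = \sum_p at_pt a p * at_pt (M *m b) p.
Proof.
rewrite /bil -mulmxA mxE -[RHS]sum_enum_val; apply: eq_bigr => i _.
by rewrite /at_pt !enum_valK mxE.
Qed.

Lemma bil_fdiag T (m : T -> R) (a b : 'cV[R]_#|T|) :
  bil a (fdiag m) b = \sum_p m p * at_pt a p * at_pt b p.
Proof.
by rewrite bil_sum_pt; apply: eq_bigr => p _; rewrite at_pt_fdiag mulrCA mulrA.
Qed.

Lemma fdiagM T (a b : T -> R) :
  fdiag a *m fdiag b = fdiag (fun p => a p * b p).
Proof.
by rewrite /fdiag mulmx_diag; congr diag_mx; apply/rowP => i; rewrite !mxE.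
Qed.

Lemma eq_fdiag T (a b : T -> R) : a =1 b -> fdiag a = fdiag b.
Proof. by move=> /funext ->. Qed.

Lemma fdiag1 T : fdiag (fun _ : T => 1) = 1%:M :> 'M[R]_#|T|.
Proof. by rewrite -diag_const_mx /fdiag; congr diag_mx; apply/rowP => i; rewrite !mxE. Qed.

Lemma fdiag_unit T (a : T -> R) : (forall p, a p != 0) -> fdiag a \in unitmx.
Proof.
move=> a0; suff /mulmx1_unit[] : fdiag a *m fdiag (fun p => (a p)^-1) = 1%:M by [].
by rewrite fdiagM -fdiag1; apply: eq_fdiag => p; rewrite mulfV.
Qed.

Lemma fmx_diag T (k : T -> T -> R) :
  (forall p q, p != q -> k p q = 0) -> fmx k = fdiag (fun p => k p p).
Proof.
move=> k0; apply/matrixP => i j; rewrite !mxE; case: eqVneq => [->|ij].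
  by rewrite mulr1n.
by rewrite mulr0n k0 // (inj_eq enum_val_inj).
Qed.

(** [e_face], [e_u] and [e_v] all unfold to this matrix, so one computation serves both blocks. Its
    transpose restricts along [m]. *)
Definition embed S T (m : S -> T) : 'M[R]_(#|T|, #|S|) :=
  fmx (fun p q => (p == m q)%:R).

Lemma at_pt_trmx_embed S T (m : S -> T) (a : 'cV[R]_#|T|) q :
  at_pt ((embed m)^T *m a) q = at_pt a (m q).
Proof.
have -> : (embed m)^T = fmx (fun q p => (p == m q)%:R).
  by apply/matrixP => i j; rewrite !mxE.
rewrite at_pt_fmx (bigD1 (m q)) //= eqxx mul1r big1 ?addr0 // => p /negPf ->.
by rewrite mul0r.
Qed.

Lemma sum_subtype (T : finType) (P : pred T) (F : T -> R) :
  \sum_(q : {p | P p}) F (val q) = \sum_(p | P p) F p.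
Proof.
rewrite [RHS](reindex_omap (val : {p | P p} -> T) insub) => [|p Pp]; last by rewrite insubT.
by apply: eq_bigl => q; rewrite valK (valP q) eqxx.
Qed.

End Labelled.

(** * Grid lines in one coordinate direction *)

Section Line.
Context (R : realType) (d N : nat).
Implicit Types (p q : grid d N) (i : 'I_d) (s : 'I_N.+1).

Definition upd i s p : grid d N := [ffun j => if j == i then s else p j].

Lemma upd_eq i s p : upd i s p i = s.
Proof. by rewrite ffunE eqxx. Qed.

Lemma upd_neq i s p j : j != i -> upd i s p j = p j.
Proof. by move=> /negPf ji; rewrite ffunE ji. Qed.

Lemma upd_upd i s r p : upd i s (upd i r p) = upd i s p.
Proof. by apply/ffunP => j; rewrite !ffunE; case: eqP. Qed.

Lemma upd_id i p : upd i (p i) p = p.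
Proof. by apply/ffunP => j; rewrite !ffunE; case: eqP => // ->. Qed.

Lemma same_lineP i p q : reflect (forall j, j != i -> p j = q j) (same_line i p q).
Proof.
apply: (iffP forallP) => [H j ji|H j]; last by apply/implyP => /H ->.
by have := H j; rewrite ji => /eqP.
Qed.

Lemma sum_line i p (F : grid d N -> R) :
  \sum_(q | same_line i p q) F q = \sum_s F (upd i s p).
Proof.
rewrite (reindex_onto (upd i ^~ p) (fun q => q i)) => [|q /same_lineP pq].
  apply: eq_bigl => s; rewrite upd_eq eqxx andbT.
  by apply/same_lineP => j ji; rewrite upd_neq.
by apply/ffunP => j; rewrite ffunE; case: eqVneq => [->|/pq].
Qed.

(* Exchanges the two points of a pair lying on a common line in direction i: this
   transposes one-dimensional operators inside a sum over the whole grid. *)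
Lemma sum_swap_line i (F : grid d N -> 'I_N.+1 -> R) :
  \sum_p \sum_s F p s = \sum_p \sum_s F (upd i s p) (p i).
Proof.
rewrite !pair_big /= (reindex_inj (h := fun x => (upd i x.2 x.1, x.1 i))) //=.
apply: (can_inj (g := fun x => (upd i x.2 x.1, x.1 i))) => -[p s] /=.
by rewrite upd_upd upd_id upd_eq.
Qed.

Lemma line_upd i s (b : grid d N -> R) p : line i b (upd i s p) = line i b p.
Proof.
by apply/rowP => r; rewrite !mxE; congr b; apply/ffunP => j; rewrite !ffunE; case: eqP.
Qed.

Lemma line_at i (b : grid d N -> R) p s : line i b p 0 s = b (upd i s p).
Proof. by rewrite mxE. Qed.

End Line.

(** * Summation by parts on the reference cube *)

Section OneDim.
Context (R : realType) (N : nat) (h1 : R) (S : sbp_op N h1).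
Implicit Types x y s r : 'I_N.+1.

(* The difference, and not a case distinction, is the boundary weight of the SBP
   identities also when N = 0 and both end points coincide. *)
Definition end_sign x : R := (x == ord_max)%:R - (x == ord0)%:R.

Lemma e_ptM r (M : 'M[R]_N.+1) x y :
  (e_pt R r *m (e_pt R r)^T *m M) x y = (x == r)%:R * M x y.
Proof.
rewrite -mulmxA mxE big_ord1 mxE eqxx andbT; case: eqVneq => [->|_]; last by rewrite !mul0r.
rewrite !mul1r mxE (bigD1 r) //= !mxE !eqxx mul1r big1 ?addr0 // => j /negPf jr.
by rewrite !mxE jr mul0r.
Qed.

Lemma addmxE m n (A B : 'M[R]_(m, n)) i j : (A + B) i j = A i j + B i j.
Proof. by rewrite mxE. Qed.

Lemma oppmxE m n (A : 'M[R]_(m, n)) i j : (- A) i j = - A i j.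
Proof. by rewrite mxE. Qed.

Lemma sbp_D_entry x s :
  sbp_w S 0 x * sbp_D S x s =
  - (sbp_D S s x * sbp_w S 0 s) + end_sign x * (x == s)%:R.
Proof.
have := congr1 (fun M : 'M[R]_N.+1 => M x s) (sbp_DP S).
rewrite /sbp_Hx mul_diag_mx mul_mx_diag mxE => ->.
(* The trailing identity gives the boundary projectors the shape required by [e_ptM]. *)
rewrite -[e_pt R ord0 *m _]mulmx1 -[e_pt R ord_max *m _]mulmx1.
rewrite !(addmxE, oppmxE) !e_ptM !mxE /end_sign; ring.
Qed.

Lemma sbp_D2_entry (b : 'rV[R]_N.+1) x s :
  sbp_w S 0 x * sbp_D2 S b x s =
  - (\sum_r sbp_D S r x * sbp_w S 0 r * b 0 r * sbp_D S r s) - sbp_Rxx S b x s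
  + end_sign x * b 0 x * sbp_D S x s.
Proof.
have := congr1 (fun M : 'M[R]_N.+1 => M x s) (sbp_D2P S b).
rewrite /sbp_Hx mul_diag_mx mxE => ->.
rewrite !(addmxE, oppmxE) -2![e_pt R _ *m _ *m _ *m _]mulmxA !e_ptM.
rewrite !mul_mx_diag !mul_diag_mx /end_sign !mxE.
under eq_bigr => r _ do rewrite !mxE.
ring.
Qed.

End OneDim.

Section Reference.
Context (R : realType) (d N : nat) (h1 : R) (S : 'I_d -> sbp_op N h1).
Implicit Types (p q : grid d N) (i k : 'I_d) (s : 'I_N.+1) (f : face d).
Implicit Types (a g w : 'cV[R]_#|grid d N|) (b : grid d N -> R).

Definition hvol p : R := \prod_j sbp_w (S j) 0 (p j).

(** Depends only on the direction of [f], not on its side or on [p f.1]; hence it is also the weight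
    of the whole grid line through [p]. *)
Definition hface f p : R := \prod_(j | j != f.1) sbp_w (S j) 0 (p j).

Lemma hvolE i t p : hvol p = sbp_w (S i) 0 (p i) * hface (i, t) p.
Proof. by rewrite /hvol (bigD1 i). Qed.

Lemma hface_gt0 f p : 0 < hface f p.
Proof. by apply: prodr_gt0 => j _; apply: sbp_w_gt0. Qed.

Lemma hvol_gt0 p : 0 < hvol p.
Proof. by apply: prodr_gt0 => j _; apply: sbp_w_gt0. Qed.

Lemma hface_upd i t s p : hface (i, t) (upd i s p) = hface (i, t) p.
Proof. by apply: eq_bigr => j ji; rewrite upd_neq. Qed.

Lemma Hface_entry_diag f p : Hface_entry S f p p = hface f p.
Proof. by apply: eq_bigr => j _; rewrite mxE eqxx. Qed.

(** Two distinct points of [f] share the coordinate [f.1], so they differ in a direction over which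
    the product runs, and that factor vanishes. *)
Lemma Hface_fdiag f : Hface S f = fdiag (fun q : facept N f => hface f (val q)).
Proof.
rewrite /Hface fmx_diag => [|p q pq].
  by apply: eq_fdiag => q; apply: Hface_entry_diag.
have [j pqj] : exists j, val p j != val q j.
  apply/existsP; rewrite -negb_forall; apply: contraNN pq => /forallP pq.
  by apply/eqP/val_inj/ffunP => j; apply/eqP.
have jf : j != f.1.
  by apply: contraNneq pqj => ->; rewrite (eqP (valP p)) (eqP (valP q)).
by rewrite /Hface_entry (bigD1 j) //= mxE (negPf pqj) mul0r.
Qed.

Lemma Hmx_fdiag : Hmx S = fdiag hvol.
Proof.
rewrite /Hmx /kron fmx_diag => [|p q pq].
  by apply: eq_fdiag => p; apply: eq_bigr => j _; rewrite mxE eqxx.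
have [j pqj] : exists j, p j != q j.
  apply/existsP; rewrite -negb_forall; apply: contraNN pq => /forallP pq.
  by apply/eqP/ffunP => j; apply/eqP.
by rewrite (bigD1 j) //= mxE (negPf pqj) mul0r.
Qed.

Lemma at_pt_line i (k : grid d N -> grid d N -> R) a p :
  at_pt (fmx (fun p q : grid d N => if same_line i p q then k p q else 0) *m a) p =
  \sum_s k p (upd i s p) * at_pt a (upd i s p).
Proof.
rewrite at_pt_fmx -(sum_line i p (fun q => k p q * at_pt a q)) [RHS]big_mkcond /=.
by apply: eq_bigr => q _; case: ifP => // _; rewrite mul0r.
Qed.

Lemma at_pt_Dmx i a p :
  at_pt (Dmx S i *m a) p = \sum_s sbp_D (S i) (p i) s * at_pt a (upd i s p).
Proof.
have -> : Dmx S i = fmx (fun p q : grid d N => if same_line i p q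
                                   then sbp_D (S i) (p i) (q i) else 0).
  congr fmx; apply/funext => x; apply/funext => y.
  rewrite (bigD1 i) //= eqxx; case: ifPn => [/same_lineP xy|].
    by rewrite big1 ?mulr1 // => j ji; rewrite (negPf ji) mxE xy // eqxx.
  (* Off the common line, one of the identity factors is zero. *)
  rewrite negb_forall => /existsP[j]; rewrite negb_imply => /andP[ji xyj].
  by rewrite (bigD1 j) //= (negPf ji) mxE (negPf xyj) mul0r mulr0.
by rewrite at_pt_line; apply: eq_bigr => s _; rewrite upd_eq.
Qed.

Lemma at_pt_D2mx i b a p :
  at_pt (D2mx S i b *m a) p =
  \sum_s sbp_D2 (S i) (line i b p) (p i) s * at_pt a (upd i s p).
Proof. by rewrite at_pt_line; apply: eq_bigr => s _; rewrite upd_eq. Qed.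

Lemma at_pt_Rmx i b a p :
  at_pt (Rmx S i b *m a) p =
  hface (i, false) p *
  \sum_s sbp_Rxx (S i) (line i b p) (p i) s * at_pt a (upd i s p).
Proof.
rewrite at_pt_line mulr_sumr; apply: eq_bigr => s _.
by rewrite upd_eq Hface_entry_diag mulrA.
Qed.

(** The boundary term of summation by parts in direction [i]: [end_sign] vanishes off the two faces
    normal to [i]. The choice of [false] is immaterial because [hface] ignores the side. *)
Definition normal_flux i (F : grid d N -> R) : R :=
  \sum_(p : grid d N) end_sign R (p i) * hface (i, false) p * F p.

(** The one-dimensional identity on every grid line, once [hvolE] has split off the weight in
    direction [i]. *)
Lemma sbp_Dmx i a g :
  \sum_p hvol p * at_pt a p * at_pt (Dmx S i *m g) p =
  - (\sum_p hvol p * at_pt (Dmx S i *m a) p * at_pt g p)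
  + normal_flux i (fun p => at_pt a p * at_pt g p).
Proof.
have -> : \sum_p hvol p * at_pt a p * at_pt (Dmx S i *m g) p =
  \sum_p \sum_s hface (i, false) p * at_pt a p *
     (sbp_w (S i) 0 (p i) * sbp_D (S i) (p i) s) * at_pt g (upd i s p).
  apply: eq_bigr => p _; rewrite at_pt_Dmx mulr_sumr; apply: eq_bigr => s _.
  rewrite (hvolE i false); ring.
under eq_bigr => p _ do under eq_bigr => s _ do
  rewrite sbp_D_entry mulrDr mulrDl.
under eq_bigr do rewrite big_split /=.
rewrite big_split /=; congr (_ + _).
  (* Swapping [p i] and [s] turns the transposed entry into the row that differentiates [a] at
     [p]. *)
  rewrite (sum_swap_line i) -sumrN; apply: eq_bigr => p _.
  rewrite at_pt_Dmx mulr_sumr mulr_suml -sumrN; apply: eq_bigr => s _.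
  rewrite upd_upd upd_id upd_eq hface_upd (hvolE i false); ring.
apply: eq_bigr => p _.
rewrite (bigD1 (p i)) //= upd_id eqxx big1 ?addr0 => [|s /negPf sp].
  rewrite mulr1n; ring.
by rewrite eq_sym sp mulr0 mulr0 mul0r.
Qed.

(** For distinct [i] and [k] this is [sbp_Dmx] with [g] equal to [b D_k w]. For [i = k], full
    compatibility yields the same volume and flux terms with the same [Dmx], and adds only [Rmx]. *)
Lemma sbp_DDmx i k b a w :
  \sum_p hvol p * at_pt a p * at_pt (DDmx S i k b *m w) p =
  - (\sum_p hvol p * b p * at_pt (Dmx S i *m a) p * at_pt (Dmx S k *m w) p)
  - (if i == k then bil a (Rmx S i b) w else 0)
  + normal_flux i (fun p => at_pt a p * (b p * at_pt (Dmx S k *m w) p)).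
Proof.
rewrite /DDmx; case: eqVneq => [<-|_]; last first.
  rewrite -!mulmxA sbp_Dmx subr0; congr (- _ + _).
    by apply: eq_bigr => p _; rewrite at_pt_fdiag; ring.
  by apply: eq_bigr => p _; rewrite at_pt_fdiag.
have -> : \sum_p hvol p * at_pt a p * at_pt (D2mx S i b *m w) p =
  \sum_p \sum_s hface (i, false) p * at_pt a p *
     (sbp_w (S i) 0 (p i) * sbp_D2 (S i) (line i b p) (p i) s) * at_pt w (upd i s p).
  apply: eq_bigr => p _; rewrite at_pt_D2mx mulr_sumr; apply: eq_bigr => s _.
  rewrite (hvolE i false); ring.
under eq_bigr => p _ do under eq_bigr => s _ do
  rewrite sbp_D2_entry !mulrDr !mulrDl.
under eq_bigr do rewrite !big_split /=.
rewrite !big_split /=; congr (_ + _ + _).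
(* Three points of one line occur: [a] sits at [p], [b] at [r] and [w] at [s]. Swapping [p] and [r]
   makes both derivatives act at the point that carries [b]. *)
- transitivity (- \sum_p \sum_r hface (i, false) p * at_pt a p *
    (\sum_s sbp_D (S i) r (p i) * sbp_w (S i) 0 r * b (upd i r p) *
      sbp_D (S i) r s * at_pt w (upd i s p))).
    rewrite -sumrN; apply: eq_bigr => p _.
    rewrite -mulr_sumr exchange_big /= mulr_sumr -sumrN; apply: eq_bigr => s _.
    rewrite -mulr_suml -mulrA -mulrN; congr (_ * _); rewrite -mulNr; congr (- _ * _).
    by apply: eq_bigr => r _; rewrite line_at.
  rewrite (sum_swap_line i); congr (- _); apply: eq_bigr => p _.
  rewrite [at_pt (Dmx S i *m a) p]at_pt_Dmx mulr_sumr mulr_suml; apply: eq_bigr => r _.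
  rewrite hface_upd upd_eq upd_upd upd_id at_pt_Dmx !mulr_sumr; apply: eq_bigr => s _.
  rewrite upd_upd (hvolE i false); ring.
- rewrite bil_sum_pt -sumrN; apply: eq_bigr => p _.
  rewrite at_pt_Rmx !mulr_sumr -sumrN; apply: eq_bigr => s _; ring.
apply: eq_bigr => p _; rewrite at_pt_Dmx !mulr_sumr; apply: eq_bigr => s _.
rewrite line_at upd_id /end_sign; ring.
Qed.

End Reference.

(** * Summation by parts for elasticity on one block *)

Section Dissipation.
Context (R : realType) (d N : nat) (h1 : R) (S : 'I_d -> sbp_op N h1).
Implicit Types (p : grid d N) (i : 'I_d) (a w : 'cV[R]_#|grid d N|).

(** Each grid line in direction [i] is represented by its point on the face [x_i = 0]. *)
Lemma sum_lines i (F : grid d N -> R) :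
  \sum_p F p = \sum_(p : grid d N | p i == ord0) \sum_s F (upd i s p).
Proof.
rewrite [RHS]big_mkcond /=.
transitivity (\sum_(p : grid d N) \sum_s (if p i == ord0 then F (upd i s p) else 0)).
  rewrite (sum_swap_line i); apply: eq_bigr => p _.
  rewrite (bigD1 ord0) //= big1 ?addr0 => [|s /negPf s0].
    by rewrite upd_eq eqxx upd_upd upd_id.
  by rewrite upd_eq s0.
by apply: eq_bigr => p _; case: ifP => // _; rewrite big1.
Qed.

Definition line_Dx i (a : 'I_(sbp_nd (S i))) (w : 'cV[R]_#|grid d N|) p
    (r : 'I_(sbp_rows a)) : R :=
  \sum_s sbp_Dx a r s * at_pt w (upd i s p).

Arguments line_Dx : clear implicits.

Lemma sbp_Rxx_entry i (b : 'rV[R]_N.+1) x y :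
  sbp_Rxx (S i) b x y =
  \sum_(a : 'I_(sbp_nd (S i))) \sum_r (\sum_s sbp_beta r s * b 0 s) * sbp_Dx a r x * sbp_Dx a r y.
Proof.
rewrite /sbp_Rxx summxE; apply: eq_bigr => a _.
rewrite -mulmxA mul_diag_mx mxE; apply: eq_bigr => r _; rewrite !mxE; ring.
Qed.

(** In this form [a] and [w] are interchangeable, and [b] enters linearly with the nonnegative
    weights [sbp_beta]; symmetry and nonnegativity of the dissipation both rest on it. *)
Lemma bil_Rmx i b a w :
  bil a (Rmx S i b) w =
  \sum_(p : grid d N | p i == ord0) hface S (i, false) p *
    \sum_(al : 'I_(sbp_nd (S i))) \sum_r (\sum_s sbp_beta r s * b (upd i s p)) *
      (line_Dx i al a p r * line_Dx i al w p r).
Proof.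
rewrite bil_sum_pt (sum_lines i); apply: eq_bigr => p _.
under eq_bigr => x _.
  rewrite at_pt_Rmx hface_upd line_upd upd_eq mulrCA mulr_sumr.
  under eq_bigr => s _ do rewrite upd_upd sbp_Rxx_entry mulr_suml mulr_sumr.
  rewrite exchange_big.
  under eq_bigr => al _.
    under eq_bigr => s _ do rewrite mulr_suml mulr_sumr.
    rewrite exchange_big.
    over.
  over.
rewrite -mulr_sumr exchange_big /=; congr (_ * _); apply: eq_bigr => al _.
rewrite exchange_big /=; apply: eq_bigr => r _.
rewrite /line_Dx big_distrlr mulr_sumr; apply: eq_bigr => x _ /=.
rewrite mulr_sumr; apply: eq_bigr => s _.
under [\sum_(z < _) sbp_beta _ _ * _]eq_bigr => z _ do rewrite line_at.
ring.
Qed.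

Lemma bil_RmxC i b a w : bil a (Rmx S i b) w = bil w (Rmx S i b) a.
Proof.
rewrite !bil_Rmx; apply: eq_bigr => p _; congr (_ * _).
by apply: eq_bigr => al _; apply: eq_bigr => r _; congr (_ * _); rewrite mulrC.
Qed.

End Dissipation.

(** * The elastic forms of one block and their Green formula *)

Section Block.
Context (R : realType) (d N : nat) (h1 : R) (b : block d N h1).
Implicit Types (p : grid d N) (f : face d) (I J K L i k : 'I_d).
Implicit Types (w a : 'I_d -> 'cV[R]_#|grid d N|) (T U : 'I_d -> 'I_d -> R).

Local Notation S := (blk_sbp b).
Local Notation F := (blk_F b).
Local Notation Jac := (blk_J b).
Local Notation C := (blk_C b).

(** The semi-inner product of the stiffness tensor at [p], symmetric by [blk_C_sym] and nonnegative
    by [blk_C_psd]. *)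
Definition elast p T U : R :=
  \sum_I \sum_J \sum_K \sum_L T I J * C I J K L p * U K L.

Lemma sum_IJKL (G : 'I_d -> 'I_d -> 'I_d -> 'I_d -> R) :
  \sum_I \sum_J \sum_K \sum_L G I J K L = \sum_J \sum_L \sum_I \sum_K G I J K L.
Proof.
rewrite exchange_big; apply: eq_bigr => J _.
under eq_bigr do rewrite exchange_big.
by rewrite exchange_big.
Qed.

Lemma elastC p T U : elast p T U = elast p U T.
Proof.
rewrite /elast; under eq_bigr do rewrite exchange_big.
rewrite exchange_big; apply: eq_bigr => K _.
under eq_bigr do rewrite exchange_big.
rewrite exchange_big; apply: eq_bigr => L _; apply: eq_bigr => I _; apply: eq_bigr => J _.
by rewrite blk_C_sym; ring.
Qed.

Lemma elast_ge0 p T : 0 <= elast p T T.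
Proof. exact: blk_C_psd. Qed.

Lemma elastDr p T U U' c :
  elast p T (fun K L => U K L + c * U' K L) = elast p T U + c * elast p T U'.
Proof.
rewrite /elast !mulr_sumr -big_split; apply: eq_bigr => I _ /=.
rewrite !mulr_sumr -big_split; apply: eq_bigr => J _ /=.
rewrite !mulr_sumr -big_split; apply: eq_bigr => K _ /=.
rewrite !mulr_sumr -big_split; apply: eq_bigr => L _ /=; ring.
Qed.

(** Expands [elast] on the square of [U + c T]. *)
Lemma elast_square p T U c :
  0 <= elast p U U + 2 * c * elast p T U + c ^+ 2 * elast p T T.
Proof.
have := elast_ge0 p (fun I J => U I J + c * T I J).
rewrite elastDr !(elastC _ (fun I J => _ + _)) !elastDr (elastC _ U T).
by congr (0 <= _); ring.
Qed.

Definition grad w p I J : R := at_pt (blk_D b I *m w J) p.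

Lemma gradE w p I J :
  grad w p I J = \sum_i F p I i * at_pt (Dmx S i *m w J) p.
Proof.
rewrite /grad /blk_D mulmx_suml at_pt_sum; apply: eq_bigr => i _.
by rewrite -mulmxA at_pt_fdiag.
Qed.

(** The rank-one tensor formed by the normal and [x]. Pairing with it expresses both the traction
    and [nCn] through [elast], so that they fit into one completed square. *)
Definition normal_mul f p (x : 'I_d -> R) I J : R := blk_n b f I p * x J.

Lemma at_pt_blk_T f J L (w : 'cV[R]_#|grid d N|) p :
  at_pt (blk_T b f J L *m w) p =
  \sum_I \sum_K blk_n b f I p * C I J K L p * at_pt (blk_D b K *m w) p.
Proof.
rewrite /blk_T mulmx_suml at_pt_sum; apply: eq_bigr => I _.
rewrite mulmx_suml at_pt_sum; apply: eq_bigr => K _.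
by rewrite -mulmxA at_pt_fdiag.
Qed.

Definition traction f w p J : R := \sum_L at_pt (blk_T b f J L *m w L) p.

Lemma tractionE f w p (x : 'I_d -> R) :
  \sum_J x J * traction f w p J = elast p (normal_mul f p x) (grad w p).
Proof.
rewrite /elast sum_IJKL; apply: eq_bigr => J _.
rewrite mulr_sumr; apply: eq_bigr => L _.
rewrite at_pt_blk_T mulr_sumr; apply: eq_bigr => I _.
rewrite mulr_sumr; apply: eq_bigr => K _; rewrite /normal_mul /grad; ring.
Qed.

Lemma nCnE f p (x : 'I_d -> R) :
  \sum_J \sum_L x J * nCn b f J L p * x L =
  elast p (normal_mul f p x) (normal_mul f p x).
Proof.
rewrite /elast sum_IJKL; apply: eq_bigr => J _; apply: eq_bigr => L _.
rewrite /nCn mulr_sumr mulr_suml; apply: eq_bigr => I _.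
rewrite mulr_sumr mulr_suml; apply: eq_bigr => K _; rewrite /normal_mul; ring.
Qed.

Lemma nCnC f J L p : nCn b f J L p = nCn b f L J p.
Proof.
rewrite /nCn exchange_big; apply: eq_bigr => I _; apply: eq_bigr => K _.
rewrite blk_C_sym; ring.
Qed.

Lemma blk_JH_fdiag : blk_JH b = fdiag (fun p => Jac p * hvol S p).
Proof. by rewrite /blk_JH /blk_H Hmx_fdiag fdiagM. Qed.

Lemma blk_JH_unit : blk_JH b \in unitmx.
Proof.
rewrite blk_JH_fdiag; apply: fdiag_unit => p.
by rewrite lt0r_neq0 // mulr_gt0 ?blk_J_gt0 ?hvol_gt0.
Qed.

Lemma sum_blk_c i J L p (y : 'I_d -> R) :
  \sum_k blk_c b i J k L p * y k =
  Jac p * \sum_I \sum_K F p I i * C I J K L p * \sum_k F p K k * y k.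
Proof.
rewrite /blk_c; move: (Jac p) => j.
under eq_bigr do rewrite mulr_suml.
rewrite exchange_big mulr_sumr; apply: eq_bigr => I _ /=.
under eq_bigr do rewrite mulr_suml.
rewrite exchange_big mulr_sumr; apply: eq_bigr => K _ /=.
rewrite !mulr_sumr; apply: eq_bigr => k _; ring.
Qed.

(** The factors [F] pass from the transformed stiffness to its arguments, where they turn reference
    derivatives into physical ones. *)
Lemma sum_sum_blk_c J L p (x y : 'I_d -> R) :
  \sum_i \sum_k blk_c b i J k L p * x i * y k =
  Jac p * \sum_I \sum_K (\sum_i F p I i * x i) * C I J K L p * \sum_k F p K k * y k.
Proof.
transitivity (\sum_i x i * \sum_k blk_c b i J k L p * y k).
  by apply: eq_bigr => i _; rewrite mulr_sumr; apply: eq_bigr => k _; ring.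
under eq_bigr do rewrite sum_blk_c mulrCA.
move: (Jac p) => j; under eq_bigr do rewrite mulr_sumr.
rewrite -mulr_sumr exchange_big; congr (_ * _); apply: eq_bigr => I _ /=.
under eq_bigr do rewrite mulr_sumr.
rewrite exchange_big; apply: eq_bigr => K _ /=.
rewrite !mulr_suml; apply: eq_bigr => i _; ring.
Qed.

Lemma blk_c_sym k J L : blk_c b k J k L = blk_c b k L k J.
Proof.
apply/funext => p; rewrite /blk_c exchange_big; apply: eq_bigr => I _.
by apply: eq_bigr => K _; rewrite blk_C_sym; move: (Jac p) => j; ring.
Qed.

(** The form is [Jac p] times [elast] on the rank-one tensor built from column [k] of [F] and
    [x]. *)
Lemma blk_c_ge0 k p (x : 'I_d -> R) :
  0 <= \sum_J \sum_L blk_c b k J k L p * (x J * x L).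
Proof.
suff -> : \sum_J \sum_L blk_c b k J k L p * (x J * x L) =
    Jac p * elast p (fun I J => F p I k * x J) (fun I J => F p I k * x J).
  by rewrite mulr_ge0 ?elast_ge0 // ltW ?blk_J_gt0.
rewrite /elast sum_IJKL /blk_c; move: (Jac p) => j.
rewrite mulr_sumr; apply: eq_bigr => J _.
rewrite mulr_sumr; apply: eq_bigr => L _.
rewrite mulr_sumr mulr_suml; apply: eq_bigr => I _.
rewrite mulr_sumr mulr_suml; apply: eq_bigr => K _; ring.
Qed.

(** Polarised, so that the strain energy, its rate and the work of the divergence operator all use
    the same form. *)
Definition strain_form a w : R :=
  \sum_I \sum_J \sum_K \sum_L
    bil (blk_D b I *m a J) (blk_JH b) (fdiag (C I J K L) *m (blk_D b K *m w L)).

Definition dissipation_form a w : R := \sum_J \sum_L bil (a J) (blk_W b J L) (w L).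

Lemma strain_formE a w :
  strain_form a w = \sum_p Jac p * hvol S p * elast p (grad a p) (grad w p).
Proof.
rewrite /strain_form blk_JH_fdiag.
under [RHS]eq_bigr do rewrite mulr_sumr.
rewrite [RHS]exchange_big; apply: eq_bigr => I _ /=.
under [RHS]eq_bigr do rewrite mulr_sumr.
rewrite [RHS]exchange_big; apply: eq_bigr => J _ /=.
under [RHS]eq_bigr do rewrite mulr_sumr.
rewrite [RHS]exchange_big; apply: eq_bigr => K _ /=.
under [RHS]eq_bigr do rewrite mulr_sumr.
rewrite [RHS]exchange_big; apply: eq_bigr => L _ /=.
rewrite bil_fdiag; apply: eq_bigr => p _; rewrite at_pt_fdiag /grad; ring.
Qed.

Lemma strain_formC a w : strain_form a w = strain_form w a.
Proof. by rewrite !strain_formE; apply: eq_bigr => p _; rewrite elastC. Qed.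

Lemma bil_blk_W J L (x y : 'cV[R]_#|grid d N|) :
  bil x (blk_W b J L) y = \sum_k bil x (Rmx S k (blk_c b k J k L)) y.
Proof. by rewrite /bil /blk_W mulmx_sumr mulmx_suml summxE. Qed.

Lemma dissipation_formC a w : dissipation_form a w = dissipation_form w a.
Proof.
rewrite /dissipation_form exchange_big; apply: eq_bigr => J _; apply: eq_bigr => L _.
rewrite !bil_blk_W; apply: eq_bigr => k _.
by rewrite bil_RmxC blk_c_sym.
Qed.

(** A single component [c_kJkL] may have either sign, so the sums over [J] and [L] are moved
    innermost. As [B_a] is linear in its coefficient with nonnegative weights, [blk_c_ge0] then
    applies at each grid point [s], with [x] made of the values of [line_Dx]. *)
Lemma dissipation_form_ge0 w : 0 <= dissipation_form w w.
Proof.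
rewrite /dissipation_form.
under eq_bigr => J _.
  under eq_bigr do rewrite bil_blk_W.
  rewrite exchange_big; over.
rewrite exchange_big; apply: sumr_ge0 => k _ /=.
under eq_bigr => J _.
  under eq_bigr do rewrite bil_Rmx.
  rewrite exchange_big; over.
rewrite exchange_big; apply: sumr_ge0 => p _ /=.
under eq_bigr do rewrite -mulr_sumr.
rewrite -mulr_sumr; apply: mulr_ge0; first exact/ltW/hface_gt0.
under eq_bigr do rewrite exchange_big.
rewrite exchange_big; apply: sumr_ge0 => al _ /=.
under eq_bigr do rewrite exchange_big.
rewrite exchange_big; apply: sumr_ge0 => r _ /=.
under eq_bigr => J _.
  under eq_bigr do rewrite mulr_suml.
  rewrite exchange_big; over.
rewrite exchange_big; apply: sumr_ge0 => s _ /=.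
under eq_bigr => J _.
  under eq_bigr do rewrite -mulrA.
  rewrite -mulr_sumr; over.
rewrite -mulr_sumr; apply: mulr_ge0; first exact: sbp_beta_ge0.
exact: blk_c_ge0.
Qed.

Definition face_wt f p : R := blk_Jhat b f p * hface S f p.

Definition face_work f a w : R :=
  \sum_(q : facept N f) face_wt f (val q) *
    \sum_J at_pt (a J) (val q) * traction f w (val q) J.

(** The sign of [end_sign] is that of the outward reference normal on each of the two faces. *)
Lemma normal_fluxE i (G : grid d N -> R) :
  normal_flux S i G =
  \sum_(t : bool) (if t then 1 else -1) *
    \sum_(q : facept N (i, t)) hface S (i, t) (val q) * G (val q).
Proof.
have sumf t : \sum_(q : facept N (i, t)) hface S (i, t) (val q) * G (val q) =
    \sum_(p : grid d N | p i == endpt N t) hface S (i, t) p * G p.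
  exact: (sum_subtype (fun p : grid d N => p i == endpt N t)
            (fun p => hface S (i, t) p * G p)).
under eq_bigr do rewrite sumf.
rewrite big_bool /= mul1r mulN1r [X in X - _]big_mkcond [X in _ - X]big_mkcond -sumrB.
apply: eq_bigr => p _ /=; rewrite /end_sign.
by case: eqP; case: eqP => _ _ /=; rewrite ?mulr1n ?mulr0n /hface /=; ring.
Qed.

(** The discrete Betti formula. For each pair [J], [L] the reference identities are summed over [i]
    and [k]; their volume, dissipation and flux parts are then identified separately. *)
Lemma block_sbp a w :
  \sum_J bil (a J) (blk_JH b) (\sum_L blk_DD b J L *m w L) =
  - (strain_form a w + dissipation_form a w) + \sum_f face_work f a w.
Proof.
have step J L : bil (a J) (blk_JH b) (blk_DD b J L *m w L) =
    - (\sum_p Jac p * hvol S p * \sum_I \sum_K grad a p I J * C I J K L p * grad w p K L)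
    - bil (a J) (blk_W b J L) (w L)
    + \sum_i normal_flux S i (fun p => at_pt (a J) p *
          \sum_k blk_c b i J k L p * at_pt (Dmx S k *m w L) p).
  rewrite blk_JH_fdiag bil_fdiag.
  (* The Jacobian in the volume weight cancels the inverse Jacobian in [blk_DD]. *)
  transitivity (\sum_i \sum_k \sum_p hvol S p * at_pt (a J) p *
      at_pt (DDmx S i k (blk_c b i J k L) *m w L) p).
    under [RHS]eq_bigr do rewrite exchange_big.
    rewrite [RHS]exchange_big; apply: eq_bigr => p _ /=.
    rewrite /blk_DD -mulmxA at_pt_fdiag mulmx_suml at_pt_sum !mulr_sumr.
    apply: eq_bigr => i _; rewrite mulmx_suml at_pt_sum !mulr_sumr.
    apply: eq_bigr => k _; have := lt0r_neq0 (blk_J_gt0 b p) => Jn0.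
    by rewrite /=; field.
  under eq_bigr do under eq_bigr do rewrite sbp_DDmx.
  under eq_bigr do rewrite !big_split /=.
  rewrite !big_split /=; congr (_ + _ + _).
  - transitivity (- \sum_p hvol S p * \sum_i \sum_k blk_c b i J k L p *
        at_pt (Dmx S i *m a J) p * at_pt (Dmx S k *m w L) p).
      under eq_bigr do rewrite sumrN exchange_big.
      rewrite sumrN exchange_big; congr (- _); apply: eq_bigr => p _ /=.
      rewrite [RHS]mulr_sumr; apply: eq_bigr => i _.
      by rewrite [RHS]mulr_sumr; apply: eq_bigr => k _; rewrite !mulrA.
    congr (- _); apply: eq_bigr => p _; rewrite sum_sum_blk_c mulrCA mulrA.
    congr (_ * _); apply: eq_bigr => I _; apply: eq_bigr => K _.
    by rewrite !gradE.
  (* Only the terms with [i = k] survive, and their sum is [blk_W]. *)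
  - rewrite bil_blk_W -sumrN; apply: eq_bigr => i _.
    rewrite sumrN -big_mkcond; congr (- _).
    by rewrite (big_pred1 i) // => k; rewrite eq_sym.
  - apply: eq_bigr => i _; rewrite /normal_flux exchange_big; apply: eq_bigr => p _ /=.
    by rewrite -mulr_sumr -mulr_sumr.
have strain_sum : strain_form a w = \sum_J \sum_L \sum_p Jac p * hvol S p *
    \sum_I \sum_K grad a p I J * C I J K L p * grad w p K L.
  rewrite strain_formE; under eq_bigr do rewrite /elast sum_IJKL mulr_sumr.
  rewrite exchange_big; apply: eq_bigr => J _ /=.
  under eq_bigr do rewrite mulr_sumr.
  by rewrite exchange_big.
have sumr J : bil (a J) (blk_JH b) (\sum_L blk_DD b J L *m w L) =
    \sum_L bil (a J) (blk_JH b) (blk_DD b J L *m w L).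
  by rewrite /bil mulmx_sumr summxE.
under eq_bigr do (rewrite sumr; under eq_bigr do rewrite step; rewrite !big_split /=).
rewrite !big_split /= opprD; congr (_ + _ + _).
- by rewrite strain_sum -sumrN; apply: eq_bigr => J _; rewrite sumrN.
- by rewrite /dissipation_form -sumrN; apply: eq_bigr => J _; rewrite sumrN.
rewrite (eq_bigr (fun f => face_work (f.1, f.2) a w)) => [|[? ?] //].
rewrite -(pair_bigA _ (fun i t => face_work (i, t) a w)) /=.
under eq_bigr do rewrite exchange_big.
rewrite exchange_big; apply: eq_bigr => i _ /=.
under eq_bigr do under eq_bigr do rewrite normal_fluxE.
under eq_bigr do rewrite exchange_big.
rewrite exchange_big; apply: eq_bigr => t _ /=.
under eq_bigr do rewrite -mulr_sumr exchange_big.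
rewrite -mulr_sumr exchange_big mulr_sumr; apply: eq_bigr => q _ /=.
rewrite !mulr_sumr; apply: eq_bigr => J _.
rewrite /traction !mulr_sumr; apply: eq_bigr => L _.
rewrite sum_blk_c at_pt_blk_T !mulr_sumr; apply: eq_bigr => I _.
rewrite !mulr_sumr; apply: eq_bigr => K _.
rewrite -[at_pt (blk_D b K *m w L) _]/(grad w _ K L) gradE.
(* The reference normal has the single component [i] here, so [Jhat] times [n_I] is the Jacobian
   times [F I i] up to the sign of the side; this turns the flux into the traction. *)
have nE : blk_n b (i, t) I (val q) =
    (blk_Jhat b (i, t) (val q))^-1 * Jac (val q) * (F (val q) I i * (if t then 1 else -1)).
  rewrite /blk_n (bigD1 i) //= big1 => [|j /negPf ji]; rewrite /outward /=.
    by rewrite eqxx addr0.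
  by rewrite ji mulr0.
rewrite nE /face_wt; have := lt0r_neq0 (@blk_Jhat_gt0 _ _ _ _ b (i, t) q) => Jn0.
by move: Jn0 => /= Jn0; field.
Qed.

End Block.

(** * Conservation of energy *)

Section Derivative.
Context (R : realType) (t : R).

(** Componentwise like [ddt], but [is_derive] carries differentiability together with the value. *)
Definition vderiv n (w : R -> 'cV[R]_n) (dw : 'cV[R]_n) : Prop :=
  forall p, is_derive t 1 (fun s : R => w s p 0) (dw p 0).

Lemma vderiv_ddt n (w : R -> 'cV[R]_n) :
  differentiable_at w t -> vderiv w (ddt w t).
Proof.
move=> dw p; rewrite /ddt mxE derive1E.
by apply: derivableP; exact: dw.
Qed.

Lemma is_derive_fsum (I : finType) (f : I -> R -> R) (df : I -> R) :
  (forall i, is_derive t 1 (f i) (df i)) ->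
  is_derive t 1 (fun s => \sum_i f i s) (\sum_i df i).
Proof.
move=> fdf.
have -> : (fun s => \sum_i f i s) = \sum_i f i.
  by apply/funext => s; rewrite fct_sumE.
elim/big_ind2 : _ => //; first exact: is_derive_cst.
by move=> g dg h dh ? ?; exact: is_deriveD.
Qed.

Lemma is_derive_scale (c : R) (f : R -> R) df :
  is_derive t 1 f df -> is_derive t 1 (fun s => c * f s) (c * df).
Proof. by move=> fdf; exact: (is_deriveZ c fdf). Qed.

Lemma is_derive_mul (f g : R -> R) df dg :
  is_derive t 1 f df -> is_derive t 1 g dg ->
  is_derive t 1 (fun s => f s * g s) (df * g t + f t * dg).
Proof.
move=> fdf gdg; apply: (is_derive_eq (is_deriveM fdf gdg)).
by rewrite addrC [g t *: df]mulrC.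
Qed.

Lemma vderivB n (w w' : R -> 'cV[R]_n) dw dw' :
  vderiv w dw -> vderiv w' dw' -> vderiv (fun s => w s - w' s) (dw - dw').
Proof.
move=> H H' p; under eq_fun do rewrite !mxE.
by rewrite !mxE; exact: is_deriveB.
Qed.

Lemma vderiv_sum n (I : finType) (w : I -> R -> 'cV[R]_n) dw :
  (forall i, vderiv (w i) (dw i)) ->
  vderiv (fun s => \sum_i w i s) (\sum_i dw i).
Proof.
move=> H p; under eq_fun do rewrite summxE.
by rewrite summxE; apply: is_derive_fsum => i; exact: H.
Qed.

Lemma vderivM m n (M : 'M[R]_(m, n)) (w : R -> 'cV[R]_n) dw :
  vderiv w dw -> vderiv (fun s => M *m w s) (M *m dw).
Proof.
move=> H p; under eq_fun do rewrite mxE.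
by rewrite mxE; apply: is_derive_fsum => j; apply: is_derive_scale; exact: H.
Qed.

Lemma is_derive_bil n (M : 'M[R]_n) (a b : R -> 'cV[R]_n) da db :
  vderiv a da -> vderiv b db ->
  is_derive t 1 (fun s => bil (a s) M (b s)) (bil da M (b t) + bil (a t) M db).
Proof.
have bilE (x y : 'cV[R]_n) : bil x M y = \sum_p x p 0 * (M *m y) p 0.
  by rewrite /bil -mulmxA mxE; apply: eq_bigr => p _; rewrite mxE.
move=> Ha Hb; under eq_fun do rewrite bilE.
rewrite !bilE -big_split /=; apply: is_derive_fsum => p.
by apply: is_derive_mul; [exact: Ha | exact: vderivM].
Qed.

End Derivative.

Lemma bilDr (R : realType) n (x : 'cV[R]_n) M y z :
  bil x M (y + z) = bil x M y + bil x M z.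
Proof. by rewrite /bil mulmxDr mxE. Qed.

Lemma bilNr (R : realType) n (x : 'cV[R]_n) (M : 'M[R]_n) y :
  bil x M (- y) = - bil x M y.
Proof. by rewrite /bil mulmxN mxE. Qed.

Lemma bilZr (R : realType) n (x : 'cV[R]_n) (M : 'M[R]_n) c y :
  bil x M (c *: y) = c * bil x M y.
Proof. by rewrite /bil -scalemxAr mxE. Qed.

(** * Rate of the block energy and work of the outer penalties *)

Section BlockEnergy.
Context (R : realType) (d N : nat) (h1 : R) (b : block d N h1) (t : R).

(** Each factor [2^-1] meets two equal terms: the mass matrices are diagonal, and the strain and
    dissipation forms are symmetric. *)
Lemma is_derive_blk_energy (w wt : 'I_d -> R -> 'cV[R]_#|grid d N|) wtt :
  (forall J, vderiv t (w J) (wt J t)) -> (forall J, vderiv t (wt J) (wtt J)) ->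
  is_derive t 1 (fun s => blk_energy b (w^~ s) (wt^~ s))
    (\sum_J bil (wt J t) (blk_JH b) (fdiag (blk_rho b) *m wtt J)
     + strain_form b (wt^~ t) (w^~ t) + dissipation_form b (wt^~ t) (w^~ t)).
Proof.
move=> dw dwt; rewrite /blk_energy.
apply: is_derive_eq.
  apply: is_deriveD; first apply: is_deriveD.
  - apply: is_derive_scale; apply: is_derive_fsum => J.
    by apply: is_derive_bil; [exact: dwt | apply: vderivM; exact: dwt].
  - apply: is_derive_scale.
    apply: is_derive_fsum => I; apply: is_derive_fsum => J.
    apply: is_derive_fsum => K; apply: is_derive_fsum => L.
    by apply: is_derive_bil; do ?[apply: vderivM]; exact: dw.
  - apply: is_derive_scale; apply: is_derive_fsum => J; apply: is_derive_fsum => L.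
    by apply: is_derive_bil; exact: dw.
congr (_ + _ + _).
- rewrite mulr_sumr; apply: eq_bigr => J _.
  rewrite blk_JH_fdiag !bil_fdiag -big_split mulr_sumr; apply: eq_bigr => p _ /=.
  by rewrite !at_pt_fdiag; field.
- transitivity (2^-1 * (strain_form b (wt^~ t) (w^~ t) + strain_form b (w^~ t) (wt^~ t))).
    congr (_ * _); rewrite /strain_form -big_split; apply: eq_bigr => I _ /=.
    rewrite -big_split; apply: eq_bigr => J _ /=.
    rewrite -big_split; apply: eq_bigr => K _ /=.
    by rewrite -big_split.
  by rewrite strain_formC; field.
transitivity (2^-1 * (dissipation_form b (wt^~ t) (w^~ t) + dissipation_form b (w^~ t) (wt^~ t))).
  congr (_ * _); rewrite /dissipation_form -big_split; apply: eq_bigr => J _ /=.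
  by rewrite -big_split.
by rewrite dissipation_formC; field.
Qed.

Lemma sum_at_pt_mulmx (T T' : finType) (A : 'M[R]_(#|T|, #|T'|)) a (y : 'cV[R]_#|T'|) :
  \sum_p at_pt a p * at_pt (A *m y) p = \sum_q at_pt (A^T *m a) q * at_pt y q.
Proof.
have dotE (X : finType) (x z : 'cV[R]_#|X|) :
    \sum_p at_pt x p * at_pt z p = (x^T *m z) 0 0.
  have /= := bil_sum_pt x 1%:M z; rewrite mul1mx => <-.
  by rewrite /bil mulmx1.
by rewrite !dotE trmx_mul trmxK mulmxA.
Qed.

Lemma sum_at_pt_embed (T : finType) (m : T -> grid d N) a (y : 'cV[R]_#|T|) :
  \sum_p at_pt a p * at_pt (embed R m *m y) p = \sum_q at_pt a (m q) * at_pt y q.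
Proof.
by rewrite sum_at_pt_mulmx; apply: eq_bigr => q _; rewrite at_pt_trmx_embed.
Qed.

(** Every penalty carries the inverse volume weight, so testing it leaves a plain Euclidean
    product. *)
Lemma bil_JH_invmx (a x : 'cV[R]_#|grid d N|) :
  bil a (blk_JH b) (invmx (blk_JH b) *m x) = \sum_p at_pt a p * at_pt x p.
Proof. by rewrite bil_sum_pt mulKVmx // blk_JH_unit. Qed.

Lemma e_faceE (f : face d) : e_face R N f = embed R (fun q : facept N f => val q).
Proof. by []. Qed.

Lemma blk_JhatF_Hface (f : face d) :
  blk_JhatF b f *m Hface (blk_sbp b) f =
  fdiag (fun q : facept N f => face_wt b f (val q)).
Proof. by rewrite Hface_fdiag /blk_JhatF fdiagM. Qed.

(** Exactly the opposite of the outer-face terms in [block_sbp]. *)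
Lemma outer_work (g : face d) (a w : 'I_d -> 'cV[R]_#|grid d N|) :
  \sum_J bil (a J) (blk_JH b) (blk_B b g w J) =
  - \sum_(f | f != g) face_work b f a w.
Proof.
transitivity (- \sum_J \sum_(f | f != g) \sum_(q : facept N f) face_wt b f (val q) *
    (at_pt (a J) (val q) * traction b f w (val q) J)).
  rewrite -sumrN; apply: eq_bigr => J _.
  rewrite /blk_B -mulmxN bil_JH_invmx.
  under eq_bigr do rewrite at_ptN mulrN.
  rewrite sumrN; congr (- _).
  under eq_bigr do rewrite at_pt_sum mulr_sumr.
  rewrite exchange_big /=; apply: eq_bigr => f _.
  rewrite /traction.
  under eq_bigr do rewrite at_pt_sum mulr_sumr.
  under [RHS]eq_bigr do rewrite !mulr_sumr.
  rewrite exchange_big [RHS]exchange_big /=; apply: eq_bigr => L _.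
  rewrite -!mulmxA e_faceE sum_at_pt_embed; apply: eq_bigr => q _.
  rewrite (mulmxA (blk_JhatF b f)) blk_JhatF_Hface at_pt_fdiag at_pt_trmx_embed; ring.
rewrite exchange_big; congr (- _); apply: eq_bigr => f _ /=.
rewrite exchange_big; apply: eq_bigr => q _ /=.
by rewrite mulr_sumr.
Qed.

End BlockEnergy.

(** * Work of the coupling terms and the energy balance *)

Section Interface.
Context (R : realType) (d N : nat) (h1 : R) (bu bv : block d N h1).
Context (G : interface bu bv) (beta : R).

Local Notation gpt := (facept N (ifc_fu G)).
Local Notation vec := 'cV[R]_#|grid d N|.
Implicit Types (u v a : 'I_d -> vec) (q : gpt) (J L : 'I_d).

Let ptu q : grid d N := val q.
Let ptv q : grid d N := val (ifc_map q).

Definition gap u v q J : R := at_pt (u J) (ptu q) - at_pt (v J) (ptv q).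

Definition ifc_wt q : R := face_wt bu (ifc_fu G) (ptu q).

Definition Zq q J L : R :=
  beta * (d%:R / (4 * h1)) * blk_Jhat bu (ifc_fu G) (ptu q) *
    (nCn bu (ifc_fu G) J L (ptu q) / blk_J bu (ptu q)
     + nCn bv (ifc_fv G) J L (ptv q) / blk_J bv (ptv q)).

Local Notation trac_u u q := (traction bu (ifc_fu G) u (ptu q)).
Local Notation trac_v v q := (traction bv (ifc_fv G) v (ptv q)).

Lemma Z_fdiag J L : Z G beta J L = fdiag (fun q => Zq q J L).
Proof. by []. Qed.

(** Reconciles the penalty of the scheme, which uses [Z L J], with the energy, which uses
    [Z J L]. *)
Lemma ZqC q J L : Zq q J L = Zq q L J.
Proof. by rewrite /Zq nCnC (nCnC bv). Qed.

(** The matching quadratures and scale factors allow the face terms of both blocks to be added point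
    by point. *)
Lemma ifc_wt_v q : face_wt bv (ifc_fv G) (ptv q) = ifc_wt q.
Proof.
rewrite /ifc_wt /face_wt -!Hface_entry_diag -/(ptu q).
by rewrite /ptv /ptu ifc_H ifc_Jhat.
Qed.

Lemma JhatG_HG : JhatG G *m HG G = fdiag ifc_wt.
Proof. exact: blk_JhatF_Hface. Qed.

Lemma face_work_u a u :
  face_work bu (ifc_fu G) a u =
  \sum_q ifc_wt q * \sum_J at_pt (a J) (ptu q) * trac_u u q J.
Proof. by []. Qed.

Lemma face_work_v a v :
  face_work bv (ifc_fv G) a v =
  \sum_q ifc_wt q * \sum_J at_pt (a J) (ptv q) * trac_v v q J.
Proof.
rewrite /face_work (reindex (@ifc_map _ _ _ _ _ _ G)) /=; last exact/onW_bij/ifc_bij.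
by apply: eq_bigr => q _; rewrite -ifc_wt_v.
Qed.

Lemma at_pt_e_u (w : vec) q : at_pt ((e_u G)^T *m w) q = at_pt w (ptu q).
Proof. exact: (at_pt_trmx_embed (fun q : gpt => val q)). Qed.

Lemma at_pt_e_v (w : vec) q : at_pt ((e_v G)^T *m w) q = at_pt w (ptv q).
Proof. exact: (at_pt_trmx_embed (fun q : gpt => val (ifc_map q))). Qed.

Lemma at_pt_delta u v L q : at_pt (delta (fun=> 0) u v L : 'cV_#|gpt|) q = gap u v q L.
Proof. by rewrite /delta subr0 at_ptB at_pt_e_u at_pt_e_v. Qed.

Lemma at_pt_sigma u v J q :
  at_pt (sigma (fun=> 0) u v J : 'cV_#|gpt|) q = trac_u u q J + trac_v v q J.
Proof.
rewrite /sigma subr0 at_ptD !at_pt_sum; congr (_ + _).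
  by apply: eq_bigr => L _; rewrite -mulmxA at_pt_e_u.
by apply: eq_bigr => L _; rewrite -mulmxA at_pt_e_v.
Qed.

Section Penalties.
Context (b : block d N h1) (pt : gpt -> grid d N) (y : 'I_d -> 'cV[R]_#|gpt|).

(** As in the next two lemmas, [b] and [pt] stay free, to be specialised to either block and its
    labelling of the interface points. *)
Lemma penalty_jump a :
  \sum_J bil (a J) (blk_JH b)
    (\sum_L invmx (blk_JH b) *m embed R pt *m Z G beta L J *m JhatG G *m HG G *m y L) =
  \sum_q ifc_wt q * \sum_J at_pt (a J) (pt q) * \sum_L Zq q J L * at_pt (y L) q.
Proof.
under [RHS]eq_bigr do rewrite mulr_sumr.
rewrite [RHS]exchange_big; apply: eq_bigr => J _ /=.
under eq_bigr do rewrite -!mulmxA.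
rewrite -mulmx_sumr bil_JH_invmx -mulmx_sumr sum_at_pt_embed; apply: eq_bigr => q _.
rewrite at_pt_sum mulrCA; congr (_ * _); rewrite mulr_sumr; apply: eq_bigr => L _.
by rewrite (mulmxA (JhatG G)) JhatG_HG Z_fdiag !at_pt_fdiag ZqC mulrCA.
Qed.

(** Transposition moves the traction operator onto the test vector, so the traction of [a]
    appears. *)
Lemma penalty_traction f a :
  \sum_J bil (a J) (blk_JH b)
    (\sum_L invmx (blk_JH b) *m (blk_T b f L J)^T *m embed R pt *m JhatG G *m HG G *m y L) =
  \sum_q ifc_wt q * \sum_J traction b f a (pt q) J * at_pt (y J) q.
Proof.
under [RHS]eq_bigr do rewrite mulr_sumr.
rewrite [RHS]exchange_big.
under [RHS]eq_bigr do under eq_bigr do rewrite /traction mulr_suml mulr_sumr.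
under [RHS]eq_bigr do rewrite exchange_big.
rewrite [RHS]exchange_big; apply: eq_bigr => J _ /=.
under eq_bigr do rewrite -!mulmxA.
rewrite -mulmx_sumr bil_JH_invmx.
under [LHS]eq_bigr do rewrite at_pt_sum mulr_sumr.
rewrite exchange_big; apply: eq_bigr => L _ /=.
rewrite sum_at_pt_mulmx trmxK sum_at_pt_embed; apply: eq_bigr => q _.
by rewrite mulmxA JhatG_HG at_pt_fdiag mulrCA.
Qed.

Lemma penalty_flux a :
  \sum_J bil (a J) (blk_JH b)
    (invmx (blk_JH b) *m embed R pt *m JhatG G *m HG G *m y J) =
  \sum_q ifc_wt q * \sum_J at_pt (a J) (pt q) * at_pt (y J) q.
Proof.
under [RHS]eq_bigr do rewrite mulr_sumr.
rewrite [RHS]exchange_big; apply: eq_bigr => J _ /=.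
rewrite -!mulmxA bil_JH_invmx sum_at_pt_embed; apply: eq_bigr => q _.
by rewrite mulmxA JhatG_HG at_pt_fdiag mulrCA.
Qed.

End Penalties.

(** Summation by parts contributes the full traction of the first block and [sigma] removes half the
    sum of both tractions, which leaves half their difference. *)
Lemma work_rhs_u a u v :
  \sum_J bil (a J) (blk_JH bu) (rhs_u G beta (fun=> 0) (fun=> 0) u v J) =
  - (strain_form bu a u + dissipation_form bu a u) +
  \sum_q ifc_wt q * \sum_J
    (2^-1 * (at_pt (a J) (ptu q) * (trac_u u q J - trac_v v q J))
     - at_pt (a J) (ptu q) * \sum_L Zq q J L * gap u v q L
     + 2^-1 * (trac_u a q J * gap u v q J)).
Proof.
have splitE n (o : 'cV[R]_n) M x y z w B :
    bil o M (x - y + 2^-1 *: z - 2^-1 *: w + B) =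
    bil o M x - bil o M y + 2^-1 * bil o M z - 2^-1 * bil o M w + bil o M B.
  by rewrite !(bilDr, bilNr, bilZr).
under eq_bigr do rewrite /rhs_u splitE.
rewrite !big_split /= !sumrN -!mulr_sumr block_sbp outer_work.
rewrite (bigD1 (ifc_fu G)) //= -!addrA; congr (_ + _).
(* [B] is the work on the outer faces, cancelled by the penalty [blk_B]. *)
have -> (X Y B W P : R) : X + (B + (- Y + (W + (P - B)))) = X - Y + W + P by ring.
rewrite -[e_u G]/(embed R ptu) penalty_jump penalty_traction penalty_flux.
rewrite face_work_u.
rewrite -sumrN !mulr_sumr -sumrN -!big_split; apply: eq_bigr => q _ /=.
rewrite !mulr_sumr -!sumrN -!big_split; apply: eq_bigr => J _ /=.
rewrite at_pt_sigma at_pt_delta.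
under eq_bigr do rewrite at_pt_delta.
by field.
Qed.

(** The same subtraction of half the sum leaves minus half the difference, so the two blocks combine
    into a product with the jump of the test vectors. *)
Lemma work_rhs_v a u v :
  \sum_J bil (a J) (blk_JH bv) (rhs_v G beta (fun=> 0) (fun=> 0) u v J) =
  - (strain_form bv a v + dissipation_form bv a v) +
  \sum_q ifc_wt q * \sum_J
    (- 2^-1 * (at_pt (a J) (ptv q) * (trac_u u q J - trac_v v q J))
     + at_pt (a J) (ptv q) * \sum_L Zq q J L * gap u v q L
     - 2^-1 * (trac_v a q J * gap u v q J)).
Proof.
have splitE n (o : 'cV[R]_n) M x y z w B :
    bil o M (x + y - 2^-1 *: z - 2^-1 *: w + B) =
    bil o M x + bil o M y - 2^-1 * bil o M z - 2^-1 * bil o M w + bil o M B.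
  by rewrite !(bilDr, bilNr, bilZr).
under eq_bigr do rewrite /rhs_v splitE.
rewrite !big_split /= !sumrN -!mulr_sumr block_sbp outer_work.
rewrite (bigD1 (ifc_fv G)) //= -!addrA; congr (_ + _).
have -> (X Y B W P : R) : X + (B + (Y + (W + (P - B)))) = X + Y + W + P by ring.
rewrite -[e_v G]/(embed R ptv) penalty_jump penalty_traction penalty_flux.
rewrite face_work_v.
rewrite !mulr_sumr -!sumrN -!big_split; apply: eq_bigr => q _ /=.
rewrite !mulr_sumr -!sumrN -!big_split; apply: eq_bigr => J _ /=.
rewrite at_pt_sigma at_pt_delta.
under eq_bigr do rewrite at_pt_delta.
by field.
Qed.

Lemma bil_ifc (x y : 'cV[R]_#|gpt|) :
  bil x (JhatG G *m HG G) y = \sum_q ifc_wt q * (at_pt x q * at_pt y q).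
Proof. by rewrite JhatG_HG bil_fdiag; apply: eq_bigr => q _; rewrite mulrA. Qed.

Let jump u v J := (e_u G)^T *m u J - (e_v G)^T *m v J.

Let traction_jump u v J :=
  \sum_L ((e_u G)^T *m (T_u G J L *m u L) - (e_v G)^T *m (T_v G J L *m v L)).

Lemma at_pt_jump u v J q : at_pt (jump u v J) q = gap u v q J.
Proof. by rewrite /jump at_ptB at_pt_e_u at_pt_e_v. Qed.

Lemma at_pt_traction_jump u v J q :
  at_pt (traction_jump u v J) q = trac_u u q J - trac_v v q J.
Proof.
rewrite /traction_jump at_pt_sum -sumrB; apply: eq_bigr => L _.
by rewrite at_ptB at_pt_e_u at_pt_e_v.
Qed.

(** Two independent pairs of arguments, since the rate of the energy pairs displacements with
    velocities. *)
Lemma jump_formE u v u' v' :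
  \sum_J \sum_L bil (jump u v J) (JhatG G *m HG G) (Z G beta J L *m jump u' v' L) =
  \sum_q ifc_wt q * \sum_J gap u v q J * \sum_L Zq q J L * gap u' v' q L.
Proof.
under [RHS]eq_bigr do rewrite mulr_sumr.
rewrite [RHS]exchange_big; apply: eq_bigr => J _ /=.
under [RHS]eq_bigr do rewrite !mulr_sumr.
rewrite [RHS]exchange_big; apply: eq_bigr => L _ /=.
rewrite bil_ifc; apply: eq_bigr => q _.
by rewrite Z_fdiag at_pt_fdiag !at_pt_jump.
Qed.

Lemma traction_formE u v u' v' :
  \sum_J bil (jump u v J) (JhatG G *m HG G) (traction_jump u' v' J) =
  \sum_q ifc_wt q * \sum_J gap u v q J * (trac_u u' q J - trac_v v' q J).
Proof.
under [RHS]eq_bigr do rewrite mulr_sumr.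
rewrite [RHS]exchange_big; apply: eq_bigr => J _ /=.
by rewrite bil_ifc; apply: eq_bigr => q _; rewrite at_pt_jump at_pt_traction_jump.
Qed.

Lemma jump_formC u v u' v' q :
  \sum_J gap u v q J * \sum_L Zq q J L * gap u' v' q L =
  \sum_J gap u' v' q J * \sum_L Zq q J L * gap u v q L.
Proof.
under eq_bigr do rewrite mulr_sumr.
rewrite exchange_big; apply: eq_bigr => L _ /=.
by rewrite mulr_sumr; apply: eq_bigr => J _; rewrite ZqC; ring.
Qed.

Lemma energyE u ut v vt :
  energy G beta u ut v vt = blk_energy bu u ut + blk_energy bv v vt
  + 2^-1 * (\sum_J \sum_L
      bil (jump u v J) (JhatG G *m HG G) (Z G beta J L *m jump u v L))
  - 2^-1 * (\sum_J bil (jump u v J) (JhatG G *m HG G) (traction_jump u v J)).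
Proof. by []. Qed.

(** Testing each equation with the velocity replaces the inertial term by [work_rhs_u] and
    [work_rhs_v]. Their volume parts cancel the strain and dissipation rates, and only interface
    sums remain. *)
Lemma energy_conservation (time : set R) (u v : 'I_d -> R -> vec) t :
  is_solution G beta (fun _ _ => 0) (fun _ _ => 0) time u v -> time t ->
  is_derive t 1
    (fun s : R => energy G beta (u^~ s) (fun J => ddt (u J) s)
                                (v^~ s) (fun J => ddt (v J) s)) 0.
Proof.
move=> sol tt.
have du J : vderiv t (u J) (ddt (u J) t).
  by case: (sol J t tt) => -[? ?] _ _ _; exact: vderiv_ddt.
have ddu J : vderiv t (ddt (u J)) (ddt (ddt (u J)) t).
  by case: (sol J t tt) => -[? ?] _ _ _; exact: vderiv_ddt.
have dv J : vderiv t (v J) (ddt (v J) t).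
  by case: (sol J t tt) => _ [? ?] _ _; exact: vderiv_ddt.
have ddv J : vderiv t (ddt (v J)) (ddt (ddt (v J)) t).
  by case: (sol J t tt) => _ [? ?] _ _; exact: vderiv_ddt.
pose ut J := ddt (u J) t; pose vt J := ddt (v J) t.
have djump J : vderiv t (fun s => jump (u^~ s) (v^~ s) J) (jump ut vt J).
  by apply: vderivB; apply: vderivM.
have dtraction J :
    vderiv t (fun s => traction_jump (u^~ s) (v^~ s) J) (traction_jump ut vt J).
  by apply: vderiv_sum => L; apply: vderivB; do 2?apply: vderivM.
have rate_u : \sum_J bil (ut J) (blk_JH bu) (fdiag (blk_rho bu) *m ddt (ddt (u J)) t) =
    \sum_J bil (ut J) (blk_JH bu) (rhs_u G beta (fun=> 0) (fun=> 0) (u^~ t) (v^~ t) J).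
  by apply: eq_bigr => J _; case: (sol J t tt) => _ _ ->.
have rate_v : \sum_J bil (vt J) (blk_JH bv) (fdiag (blk_rho bv) *m ddt (ddt (v J)) t) =
    \sum_J bil (vt J) (blk_JH bv) (rhs_v G beta (fun=> 0) (fun=> 0) (u^~ t) (v^~ t) J).
  by apply: eq_bigr => J _; case: (sol J t tt) => _ _ _ ->.
have dEu : is_derive t 1 (fun s => blk_energy bu (u^~ s) (fun J => ddt (u J) s))
    (\sum_J bil (ut J) (blk_JH bu) (rhs_u G beta (fun=> 0) (fun=> 0) (u^~ t) (v^~ t) J)
     + strain_form bu ut (u^~ t) + dissipation_form bu ut (u^~ t)).
  rewrite -rate_u.
  exact: (is_derive_blk_energy bu (wt := fun J => ddt (u J)) du ddu).
have dEv : is_derive t 1 (fun s => blk_energy bv (v^~ s) (fun J => ddt (v J) s))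
    (\sum_J bil (vt J) (blk_JH bv) (rhs_v G beta (fun=> 0) (fun=> 0) (u^~ t) (v^~ t) J)
     + strain_form bv vt (v^~ t) + dissipation_form bv vt (v^~ t)).
  rewrite -rate_v.
  exact: (is_derive_blk_energy bv (wt := fun J => ddt (v J)) dv ddv).
have dEjump : is_derive t 1 (fun s => 2^-1 * (\sum_J \sum_L
      bil (jump (u^~ s) (v^~ s) J) (JhatG G *m HG G)
        (Z G beta J L *m jump (u^~ s) (v^~ s) L)))
    (\sum_q ifc_wt q * \sum_J gap ut vt q J * \sum_L Zq q J L * gap (u^~ t) (v^~ t) q L).
  apply: (is_derive_eq (is_derive_scale 2^-1 (is_derive_fsum (fun J =>
    is_derive_fsum (fun L => is_derive_bil (JhatG G *m HG G) (djump J)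
                               (vderivM (Z G beta J L) (djump L))))))).
  under eq_bigr do rewrite big_split /=.
  rewrite big_split /= !jump_formE.
  under [X in _ + X]eq_bigr do rewrite jump_formC.
  by field.
(* This form is not manifestly symmetric, so both product-rule terms are kept; they match the two
   kinds of half-weighted terms in the work of the penalties. *)
have dEtraction : is_derive t 1 (fun s => 2^-1 * (\sum_J
      bil (jump (u^~ s) (v^~ s) J) (JhatG G *m HG G) (traction_jump (u^~ s) (v^~ s) J)))
    (\sum_q ifc_wt q * \sum_J 2^-1 *
       (gap ut vt q J * (trac_u (u^~ t) q J - trac_v (v^~ t) q J)
        + gap (u^~ t) (v^~ t) q J * (trac_u ut q J - trac_v vt q J))).
  apply: (is_derive_eq (is_derive_scale 2^-1 (is_derive_fsum (fun J =>
    is_derive_bil (JhatG G *m HG G) (djump J) (dtraction J))))).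
  rewrite big_split /= !traction_formE -big_split mulr_sumr; apply: eq_bigr => q _ /=.
  by rewrite -mulrDr mulrCA -big_split mulr_sumr.
under eq_fun do rewrite energyE.
apply: (is_derive_eq (is_deriveB (is_deriveD (is_deriveD dEu dEv) dEjump) dEtraction)).
rewrite work_rhs_u work_rhs_v.
have cancel (S W I S' W' I' P Q : R) : I + I' + P - Q = 0 ->
    (- (S + W) + I + S + W) + (- (S' + W') + I' + S' + W') + P - Q = 0.
  by move=> <-; ring.
apply: cancel.
(* The interface terms cancel at each point and for each component, once the gap of the velocities
   is split into its two sides. *)
rewrite -sumrN -!big_split /= big1 // => q _.
rewrite -!mulrN -!mulrDr -sumrN -!big_split /= big1 ?mulr0 // => J _.
by rewrite /gap; field.
Qed.

End Interface.

(** * Nonnegativity of the energy *)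

(** The far end follows from the near one by the symmetry [sbp_wsym]. *)
Lemma sbp_w_endpt (R : realType) (N : nat) (h1 : R) (S : sbp_op N h1) t :
  sbp_w S 0 (endpt N t) = h1.
Proof.
case: t; last exact: sbp_w0.
rewrite -[RHS](sbp_w0 S) -[RHS](sbp_wsym S); congr (sbp_w S 0 _).
by apply: val_inj; rewrite /= subSS subn0.
Qed.

Section FaceBound.
Context (R : realType) (d N : nat) (h1 : R) (b : block d N h1) (f : face d).
Implicit Types (q : facept N f) (w : 'I_d -> 'cV[R]_#|grid d N|).

Lemma spacing_gt0 : 0 < h1.
Proof. by have := sbp_w_gt0 (blk_sbp b f.1) ord0; rewrite sbp_w0. Qed.

(** At the points of [f] the volume weight is [h1] times the face weight; the other points
    contribute nonnegative terms, which are dropped. *)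
Lemma strain_form_face w :
  \sum_(q : facept N f) blk_J b (val q) * (h1 * hface (blk_sbp b) f (val q)) *
    elast b (val q) (grad b w (val q)) (grad b w (val q)) <= strain_form b w w.
Proof.
rewrite strain_formE (bigID (fun p : grid d N => p f.1 == endpt N f.2)) /=.
rewrite (sum_subtype (fun p : grid d N => p f.1 == endpt N f.2)
  (fun p => blk_J b p * (h1 * hface (blk_sbp b) f p) *
            elast b p (grad b w p) (grad b w p))).
rewrite -[X in X <= _]addr0 lerD //; last first.
  apply: sumr_ge0 => p _; rewrite mulr_ge0 ?elast_ge0 // mulr_ge0 ?ltW //.
    exact: blk_J_gt0.
  exact: hvol_gt0.
apply: ler_sum => p /eqP pf.
by rewrite (hvolE _ f.1 f.2) pf sbp_w_endpt -surjective_pairing.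
Qed.

(* Uses the square of grad w + c Jhat / (2 h1 J) (n x), weighted by J h1 H_f. *)
Lemma face_square q w (x : 'I_d -> R) (kappa c : R) :
  1 <= kappa -> c ^+ 2 = 1 ->
  0 <= blk_J b (val q) * (h1 * hface (blk_sbp b) f (val q)) *
         elast b (val q) (grad b w (val q)) (grad b w (val q))
       + face_wt b f (val q) * (kappa / (4 * h1) * blk_Jhat b f (val q) *
           (\sum_J \sum_L x J * nCn b f J L (val q) * x L) / blk_J b (val q))
       + c * (face_wt b f (val q) * \sum_J x J * traction b f w (val q) J).
Proof.
move=> kappa1 c1; rewrite nCnE tractionE /face_wt.
have := elast_square b (val q) (normal_mul b f (val q) x) (grad b w (val q))
  (c * (blk_Jhat b f (val q) / (2 * h1 * blk_J b (val q)))).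
have := elast_ge0 b (val q) (normal_mul b f (val q) x).
have := spacing_gt0; have := @blk_Jhat_gt0 _ _ _ _ b f q.
have := hface_gt0 (blk_sbp b) f (val q); have := blk_J_gt0 b (val q).
move: (blk_J b _) (hface _ _ _) (blk_Jhat _ _ _) (elast _ _ _ _) (elast _ _ _ _)
  (elast _ _ _ _) => j h a G E X j0 h0 a0 s0.
rewrite exprMn c1 mul1r => X0 square_ge0.
(* The shift [a / (2 * h1 * j)] makes the cross term of the square equal to [c * (a * h * G)]. Its
   quadratic part uses the share of [X] for [kappa = 1]; the excess [kappa - 1] stays as a
   nonnegative remainder. *)
have -> : j * (h1 * h) * E + a * h * (kappa / (4 * h1) * a * X / j) + c * (a * h * G) =
    j * (h1 * h) * (E + 2 * (c * (a / (2 * h1 * j))) * G + (a / (2 * h1 * j)) ^+ 2 * X)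
    + (kappa - 1) * (a ^+ 2 * h / (4 * h1 * j) * X).
  by field; rewrite !gt_eqF.
rewrite addr_ge0 // mulr_ge0 ?subr_ge0 //; first by rewrite !mulr_ge0 ?ltW.
by rewrite mulr_ge0 // divr_ge0 ?mulr_ge0 ?exprn_ge0 ?ltW.
Qed.

End FaceBound.

(** The kinetic and dissipative parts are nonnegative, and the strain part is bounded below by its
    face points. *)
Lemma blk_energy_ge (R : realType) (d N : nat) (h1 : R) (b : block d N h1)
    (f : face d) (w wt : 'I_d -> 'cV[R]_#|grid d N|) :
  2^-1 * (\sum_(q : facept N f) blk_J b (val q) * (h1 * hface (blk_sbp b) f (val q)) *
    elast b (val q) (grad b w (val q)) (grad b w (val q))) <= blk_energy b w wt.
Proof.
rewrite -[blk_energy b w wt]/(_ + 2^-1 * strain_form b w w + 2^-1 * dissipation_form b w w).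
rewrite -[X in X <= _]add0r -[X in X <= _]addr0 lerD ?mulr_ge0 ?dissipation_form_ge0 //.
rewrite lerD ?ler_pM2l ?strain_form_face // mulr_ge0 //; apply: sumr_ge0 => J _.
rewrite blk_JH_fdiag bil_fdiag; apply: sumr_ge0 => p _; rewrite at_pt_fdiag.
rewrite -mulrA mulr_ge0 //; first by rewrite mulr_ge0 ?ltW ?blk_J_gt0 ?hvol_gt0.
by rewrite mulrCA mulr_ge0 ?(ltW (blk_rho_gt0 b p)) // -expr2 sqr_ge0.
Qed.

(** Separates the penalty into one share per block, each paying for the square of that block. *)
Lemma Zq_quad (R : realType) (d N : nat) (h1 : R) (bu bv : block d N h1)
    (G : interface bu bv) (beta : R) (q : facept N (ifc_fu G)) (x : 'I_d -> R) :
  \sum_J x J * \sum_L Zq beta q J L * x L =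
  beta * d%:R / (4 * h1) * blk_Jhat bu (ifc_fu G) (val q) *
    (\sum_J \sum_L x J * nCn bu (ifc_fu G) J L (val q) * x L) / blk_J bu (val q) +
  beta * d%:R / (4 * h1) * blk_Jhat bu (ifc_fu G) (val q) *
    (\sum_J \sum_L x J * nCn bv (ifc_fv G) J L (val (ifc_map q)) * x L)
    / blk_J bv (val (ifc_map q)).
Proof.
rewrite /Zq; move: (blk_J bu _) (blk_J bv _) (blk_Jhat _ _ _) => ju jv a.
rewrite !mulr_sumr !mulr_suml -big_split; apply: eq_bigr => J _ /=.
rewrite !mulr_sumr !mulr_suml -big_split; apply: eq_bigr => L _ /=; ring.
Qed.

Lemma energy_ge0 (R : realType) (d N : nat) (h1 : R) (bu bv : block d N h1)
    (G : interface bu bv) (beta : R) (u ut v vt : 'I_d -> 'cV[R]_#|grid d N|) :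
  1 <= beta -> 0 <= energy G beta u ut v vt.
Proof.
move=> beta1; rewrite energyE jump_formE traction_formE.
have kappa1 : 1 <= beta * d%:R.
  (* The direction of the interface face is an element of ['I_d]. *)
  have d_gt0 : (0 < d)%N by case: (ifc_fu G) => -[m md] _; exact: leq_trans md.
  by rewrite -[X in X <= _]mulr1 ler_pM // ler1n.
have Eu := blk_energy_ge bu (ifc_fu G) u ut.
have := blk_energy_ge bv (ifc_fv G) v vt.
rewrite (reindex (@ifc_map _ _ _ _ _ _ G)) /=; last exact/onW_bij/ifc_bij.
move=> Ev; apply: le_trans (lerB (lerD (lerD Eu Ev) (lexx _)) (lexx _)).
rewrite -!mulrDr -mulrBr mulr_ge0 // -sumrN -!big_split /=; apply: sumr_ge0 => q _.
(* The energy contains minus the gap times the first traction and plus the gap times the second;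
   hence [c = -1] for the first block and [c = 1] for the second, with the same gap. *)
have sq1 : (-1) ^+ 2 = 1 :> R by rewrite sqrrN expr1n.
have := @face_square _ _ _ _ bu (ifc_fu G) q u (gap u v q) _ _ kappa1 sq1.
have := @face_square _ _ _ _ bv (ifc_fv G) (ifc_map q) v (gap u v q) _ _ kappa1 (expr1n _ 2).
rewrite ifc_wt_v -ifc_Jhat.
move=> /addr_ge0/[apply]; congr (0 <= _); rewrite Zq_quad.
under [X in _ = _ + _ * _ - _ * X]eq_bigr do rewrite mulrBr.
rewrite sumrB /= -[face_wt bu _ _]/(ifc_wt q); ring.
Qed.

Theorem theorem4 (R : realType) (d N : nat) (hN : (0 < N)%N) (h1 : R)
    (bu bv : block d N h1) (G : interface bu bv)
    (beta : R) (hbeta : 1 <= beta) :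
  (forall (time : set R) (u v : 'I_d -> R -> 'cV[R]_#|grid d N|),
     open time ->
     is_solution G beta (fun _ _ => 0) (fun _ _ => 0) time u v ->
     forall t : R, time t ->
       is_derive t 1
         (fun s : R => energy G beta (fun J => u J s) (fun J => ddt (u J) s)
                                     (fun J => v J s) (fun J => ddt (v J) s))
         0)
  /\ (forall u ut v vt : 'I_d -> 'cV[R]_#|grid d N|,
        0 <= energy G beta u ut v vt).
Proof.
split=> [time u v _ sol t tt | u ut v vt]; last exact: energy_ge0.
exact: energy_conservation sol tt.
Qed.
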